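(* Let $\mathbf{k}$ be a field of characteristic $0$, and let $\psi\in\mathfrak{grt}_1(\mathbf{k})$ be homogeneous of degree $n$ (where $A,B$ have degree $1$). If $n$ is odd and $n\geq 3$, then the image $[\psi]$ of $\psi$ in $\mathfrak{p}/[\mathfrak{p},\mathfrak{p}]$ is proportional to $[\sigma_n]$, i.e. $i([\psi])$ is a scalar multiple (with scalar in $\mathbf{k}$) of $(\overline A+\overline B)^n-\overline A^n-\overline B^n$. Otherwise, $[\psi]=0$.
   Context: $\mathfrak{f}_2(A,B)$ is the free Lie algebra over $\mathbf{k}$ on generators $A,B$, graded by $\deg A=\deg B=1$. For $n\ge 2$, $\mathfrak{t}_n$ is the Lie algebra over $\mathbf{k}$ with generators $t_{ij}$ ($i\neq j\in\{1,\dots,n\}$) and relations $t_{ij}=t_{ji}$, $[t_{ij}+t_{ik},t_{jk}]=0$ for $i,j,k$ distinct, $[t_{ij},t_{kl}]=0$ for $i,j,k,l$ all distinct. If $I_1,\dots,I_n$ are disjoint subsets of $\{1,\dots,m\}$, the Lie algebra morphism $\mathfrak{t}_n\to\mathfrak{t}_m$, $\psi\mapsto\psi^{I_1,\dots,I_n}$, is defined by $t_{ij}\mapsto\sum_{\alpha\in I_i,\beta\in I_j}t_{\alpha\beta}$ (a subset such as $\{1,2\}$ is written $12$). $\mathfrak{t}_3$ is the direct sum of its center $\mathbf{k}(t_{12}+t_{13}+t_{23})$ and the free Lie algebra generated by $t_{12},t_{23}$; one identifies $A=t_{12}$, $B=t_{23}$, so that $\mathfrak{f}_2(A,B)\subset\mathfrak{t}_3$.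 $\mathfrak{grt}_1(\mathbf{k})$ is the set of all $\psi\in\mathfrak{f}_2(A,B)$ such that: (1) $\psi(B,A)=-\psi(A,B)$; (2) $\psi(A,B)+\psi(B,C)+\psi(C,A)=0$ where $C=-A-B$; (3) $\psi^{12,3,4}-\psi^{1,23,4}+\psi^{1,2,34}=\psi^{2,3,4}+\psi^{1,2,3}$ in $\mathfrak{t}_4$. $\mathfrak{p}\subset\mathfrak{f}_2(A,B)$ is the commutator subalgebra $[\mathfrak{f}_2(A,B),\mathfrak{f}_2(A,B)]$, i.e. the sum of the components of degree $>1$. One has $\mathfrak{grt}_1(\mathbf{k})\subset\mathfrak{p}$, a graded subspace. For $k,\ell\ge1$, $p_{k\ell}$ is the class of $\operatorname{ad}(A)^{k-1}\operatorname{ad}(B)^{\ell-1}([A,B])$ in $\mathfrak{p}/[\mathfrak{p},\mathfrak{p}]$; these classes form a basis, and $i:\mathfrak{p}/[\mathfrak{p},\mathfrak{p}]\to(\overline A\,\overline B)\subset\mathbf{k}[\overline A,\overline B]$ is the linear isomorphism $p_{k\ell}\mapsto\overline A^k\overline B^\ell$ onto the ideal generated by $\overline A\,\overline B$ in the commutative polynomial ring. For $n=3,5,7,\dots$, $\sigma_n\in\mathfrak{grt}_1(\mathbf{k})$ denotes Drinfeld's element; its class $[\sigma_n]\in\mathfrak{p}/[\mathfrak{p},\mathfrak{p}]$ satisfies $i([\sigma_n])=(\overline A+\overline B)^n-\overline A^n-\overline B^n$. *)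

(* Defs.v *)
From HB Require Import structures.
From mathcomp Require Import all_boot all_order all_algebra.
From mathcomp Require Import boolp mpoly ring.

Set Implicit Arguments.
Unset Strict Implicit.
Unset Printing Implicit Defensive.

Import GRing.Theory.
Local Open Scope ring_scope.

HB.mixin Record isLieAlgebra (K : fieldType) L of GRing.Lmodule K L := {
  lie_br : L -> L -> L;
  lie_brDl : forall x y z, lie_br (x + y) z = lie_br x z + lie_br y z;
  lie_brDr : forall x y z, lie_br x (y + z) = lie_br x y + lie_br x z;
  lie_brZl : forall (c : K) x y, lie_br (c *: x) y = c *: lie_br x y;
  lie_brZr : forall (c : K) x y, lie_br x (c *: y) = c *: lie_br x y;
  lie_brxx : forall x, lie_br x x = 0;
  lie_jacobi : forall x y z,
    lie_br x (lie_br y z) + lie_br y (lie_br z x) + lie_br z (lie_br x y) = 0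
}.

#[short(type="lieAlgType")]
HB.structure Definition LieAlgebra (K : fieldType) :=
  {L of GRing.Lmodule K L & isLieAlgebra K L}.

Notation "[ 'lie' x , y ]" := (lie_br x y)
  (at level 0, format "[ 'lie'  x ,  y ]") : ring_scope.

Section LieTheory.
Variables (K : fieldType) (L : lieAlgType K).
Implicit Types x y z : L.

Lemma lie_br0l x : [lie (0 : L), x] = 0.
Proof. by rewrite -{1}(scale0r (0 : L)) lie_brZl scale0r. Qed.
Lemma lie_br0r x : [lie x, (0 : L)] = 0.
Proof. by rewrite -{1}(scale0r (0 : L)) lie_brZr scale0r. Qed.
Lemma lie_brC x y : [lie x, y] = - [lie y, x].
Proof.
have := lie_brxx (x + y); rewrite lie_brDl !lie_brDr !lie_brxx add0r addr0.
by move/eqP; rewrite addr_eq0 => /eqP.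
Qed.
Lemma lie_brNl x y : [lie - x, y] = - [lie x, y].
Proof. by rewrite -scaleN1r lie_brZl scaleN1r. Qed.
Lemma lie_brNr x y : [lie x, - y] = - [lie x, y].
Proof. by rewrite -scaleN1r lie_brZr scaleN1r. Qed.
Lemma lie_br_suml I (r : seq I) (P : pred I) (F : I -> L) y :
  [lie \sum_(i <- r | P i) F i, y] = \sum_(i <- r | P i) [lie F i, y].
Proof.
by apply: (big_morph (fun x => [lie x, y])) => [u v|]; rewrite ?lie_brDl ?lie_br0l.
Qed.
Lemma lie_br_sumr I (r : seq I) (P : pred I) (F : I -> L) x :
  [lie x, \sum_(i <- r | P i) F i] = \sum_(i <- r | P i) [lie x, F i].
Proof.
by apply: (big_morph (lie_br x)) => [u v|]; rewrite ?lie_brDr ?lie_br0r.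
Qed.
Lemma lie_adD x y z : [lie x, [lie y, z]] = [lie y, [lie x, z]] + [lie [lie x, y], z].
Proof.
have /eqP := lie_jacobi x y z; rewrite -addrA addr_eq0 => /eqP ->.
rewrite opprD; congr (_ + _); first by rewrite (lie_brC z x) lie_brNr opprK.
by rewrite (lie_brC z) opprK.
Qed.

End LieTheory.

Inductive lterm (K : fieldType) (X : Type) : Type :=
| LGen of X
| LZero
| LAdd of lterm K X & lterm K X
| LScale of K & lterm K X
| LBr of lterm K X & lterm K X.
Arguments LGen {K X}.
Arguments LZero {K X}.

HB.instance Definition _ K X := gen_eqMixin (lterm K X).
HB.instance Definition _ K X := gen_choiceMixin (lterm K X).

Section Presentation.
Variables (K : fieldType) (X : Type) (rel : lterm K X -> lterm K X -> Prop).
Local Notation term := (lterm K X).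

(* The quotient of the Lie terms by lie_eqv is the Lie algebra presented by the
   generators X and the relations u = v for rel u v; negation is scaling by -1 *)
Inductive lie_eqv : term -> term -> Prop :=
| lie_eqv_rel u v : rel u v -> lie_eqv u v
| lie_eqv_refl u : lie_eqv u u
| lie_eqv_sym u v : lie_eqv u v -> lie_eqv v u
| lie_eqv_trans v u w : lie_eqv u v -> lie_eqv v w -> lie_eqv u w
| lie_eqv_add u u' v v' : lie_eqv u u' -> lie_eqv v v' ->
    lie_eqv (LAdd u v) (LAdd u' v')
| lie_eqv_scale c u u' : lie_eqv u u' -> lie_eqv (LScale c u) (LScale c u')
| lie_eqv_br u u' v v' : lie_eqv u u' -> lie_eqv v v' ->
    lie_eqv (LBr u v) (LBr u' v')
| lie_eqv_addA u v w : lie_eqv (LAdd u (LAdd v w)) (LAdd (LAdd u v) w)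
| lie_eqv_addC u v : lie_eqv (LAdd u v) (LAdd v u)
| lie_eqv_add0 u : lie_eqv (LAdd LZero u) u
| lie_eqv_addN u : lie_eqv (LAdd (LScale (- 1) u) u) LZero
| lie_eqv_scaleA a b u : lie_eqv (LScale a (LScale b u)) (LScale (a * b) u)
| lie_eqv_scale1 u : lie_eqv (LScale 1 u) u
| lie_eqv_scaleDr a u v :
    lie_eqv (LScale a (LAdd u v)) (LAdd (LScale a u) (LScale a v))
| lie_eqv_scaleDl a b u :
    lie_eqv (LScale (a + b) u) (LAdd (LScale a u) (LScale b u))
| lie_eqv_brDl u v w : lie_eqv (LBr (LAdd u v) w) (LAdd (LBr u w) (LBr v w))
| lie_eqv_brDr u v w : lie_eqv (LBr u (LAdd v w)) (LAdd (LBr u v) (LBr u w))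
| lie_eqv_brZl c u v : lie_eqv (LBr (LScale c u) v) (LScale c (LBr u v))
| lie_eqv_brZr c u v : lie_eqv (LBr u (LScale c v)) (LScale c (LBr u v))
| lie_eqv_brxx u : lie_eqv (LBr u u) LZero
| lie_eqv_jacobi u v w :
    lie_eqv (LAdd (LAdd (LBr u (LBr v w)) (LBr v (LBr w u))) (LBr w (LBr u v)))
            LZero.

Definition lie_eqvb (u v : term) : bool := `[< lie_eqv u v >].

Lemma lie_eqvb_equiv : equiv_class_of lie_eqvb.
Proof.
split=> [u|u v|v u w].
- exact/asboolP/lie_eqv_refl.
- by apply/asboolP/asboolP; apply: lie_eqv_sym.
- by move=> /asboolP uv /asboolP vw; apply/asboolP/(lie_eqv_trans uv vw).
Qed.

Canonical lie_eqvb_equivRel := EquivRelPack lie_eqvb_equiv.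
Canonical lie_eqvb_encModRel := defaultEncModRel lie_eqvb.

Local Open Scope quotient_scope.

Definition lie_pres : Type := {eq_quot lie_eqvb}.

HB.instance Definition _ : EqQuotient term lie_eqvb lie_pres :=
  EqQuotient.on lie_pres.
HB.instance Definition _ := Choice.on lie_pres.

Definition lp_cls (u : term) : lie_pres := \pi_lie_pres u.

Lemma lp_clsP u v : lp_cls u = lp_cls v <-> lie_eqv u v.
Proof.
split; first by move/eqmodP/asboolP.
by move=> uv; apply/eqmodP/asboolP.
Qed.

Lemma lp_repr u : lie_eqv (repr (lp_cls u)) u.
Proof. by apply/lp_clsP; rewrite /lp_cls reprK. Qed.

Lemma lp_clsE (x : lie_pres) : lp_cls (repr x) = x.
Proof. exact: reprK. Qed.

Definition lp_add (x y : lie_pres) := lp_cls (LAdd (repr x) (repr y)).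
Definition lp_scale (c : K) (x : lie_pres) := lp_cls (LScale c (repr x)).
Definition lp_opp (x : lie_pres) := lp_scale (- 1) x.
Definition lp_br (x y : lie_pres) := lp_cls (LBr (repr x) (repr y)).

Lemma lp_addE u v : lp_add (lp_cls u) (lp_cls v) = lp_cls (LAdd u v).
Proof. by apply/lp_clsP/lie_eqv_add; apply: lp_repr. Qed.
Lemma lp_scaleE c u : lp_scale c (lp_cls u) = lp_cls (LScale c u).
Proof. exact/lp_clsP/lie_eqv_scale/lp_repr. Qed.
Lemma lp_brE u v : lp_br (lp_cls u) (lp_cls v) = lp_cls (LBr u v).
Proof. by apply/lp_clsP/lie_eqv_br; apply: lp_repr. Qed.

Definition lp_E := (lp_addE, lp_scaleE, lp_brE).

Fact lp_addA : associative lp_add.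
Proof.
move=> x y z; rewrite -(lp_clsE x) -(lp_clsE y) -(lp_clsE z) !lp_E.
exact/lp_clsP/lie_eqv_addA.
Qed.
Fact lp_addC : commutative lp_add.
Proof.
by move=> x y; rewrite -(lp_clsE x) -(lp_clsE y) !lp_E; apply/lp_clsP/lie_eqv_addC.
Qed.
Fact lp_add0 : left_id (lp_cls LZero) lp_add.
Proof. by move=> x; rewrite -(lp_clsE x) !lp_E; apply/lp_clsP/lie_eqv_add0. Qed.
Fact lp_addN : left_inverse (lp_cls LZero) lp_opp lp_add.
Proof.
by move=> x; rewrite -(lp_clsE x) /lp_opp !lp_E; apply/lp_clsP/lie_eqv_addN.
Qed.

HB.instance Definition _ :=
  GRing.isZmodule.Build lie_pres lp_addA lp_addC lp_add0 lp_addN.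

Fact lp_scaleA a b x : lp_scale a (lp_scale b x) = lp_scale (a * b) x.
Proof. by rewrite -(lp_clsE x) !lp_E; apply/lp_clsP/lie_eqv_scaleA. Qed.
Fact lp_scale1 : left_id 1 lp_scale.
Proof. by move=> x; rewrite -(lp_clsE x) !lp_E; apply/lp_clsP/lie_eqv_scale1. Qed.
Fact lp_scaleDr : right_distributive lp_scale +%R.
Proof.
move=> a x y; rewrite -(lp_clsE x) -(lp_clsE y) /GRing.add /= !lp_E.
exact/lp_clsP/lie_eqv_scaleDr.
Qed.
Fact lp_scaleDl x : {morph lp_scale^~ x : a b / a + b}.
Proof.
move=> a b; rewrite -(lp_clsE x) [RHS]/GRing.add /= !lp_E.
exact/lp_clsP/lie_eqv_scaleDl.
Qed.

HB.instance Definition _ := GRing.Zmodule_isLmodule.Build K lie_pres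
  lp_scaleA lp_scale1 lp_scaleDr lp_scaleDl.

Lemma lp_cls0 : lp_cls LZero = 0. Proof. by []. Qed.
Lemma lp_clsD u v : lp_cls (LAdd u v) = lp_cls u + lp_cls v.
Proof. by rewrite -lp_addE. Qed.
Lemma lp_clsZ c u : lp_cls (LScale c u) = c *: lp_cls u.
Proof. by rewrite -lp_scaleE. Qed.

Fact lp_brDl x y z : lp_br (x + y) z = lp_br x z + lp_br y z.
Proof.
rewrite -(lp_clsE x) -(lp_clsE y) -(lp_clsE z) -lp_clsD !lp_E -lp_clsD.
exact/lp_clsP/lie_eqv_brDl.
Qed.
Fact lp_brDr x y z : lp_br x (y + z) = lp_br x y + lp_br x z.
Proof.
rewrite -(lp_clsE x) -(lp_clsE y) -(lp_clsE z) -lp_clsD !lp_E -lp_clsD.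
exact/lp_clsP/lie_eqv_brDr.
Qed.
Fact lp_brZl (c : K) x y : lp_br (c *: x) y = c *: lp_br x y.
Proof.
rewrite -(lp_clsE x) -(lp_clsE y) -lp_clsZ !lp_E -lp_clsZ.
exact/lp_clsP/lie_eqv_brZl.
Qed.
Fact lp_brZr (c : K) x y : lp_br x (c *: y) = c *: lp_br x y.
Proof.
rewrite -(lp_clsE x) -(lp_clsE y) -lp_clsZ !lp_E -lp_clsZ.
exact/lp_clsP/lie_eqv_brZr.
Qed.
Fact lp_brxx x : lp_br x x = 0.
Proof. by rewrite -(lp_clsE x) !lp_E; apply/lp_clsP/lie_eqv_brxx. Qed.
Fact lp_jacobi x y z :
  lp_br x (lp_br y z) + lp_br y (lp_br z x) + lp_br z (lp_br x y) = 0.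
Proof.
rewrite -(lp_clsE x) -(lp_clsE y) -(lp_clsE z) !lp_E -!lp_clsD.
exact/lp_clsP/lie_eqv_jacobi.
Qed.

HB.instance Definition _ := isLieAlgebra.Build K lie_pres
  lp_brDl lp_brDr lp_brZl lp_brZr lp_brxx lp_jacobi.

Definition lp_gen (x : X) : lie_pres := lp_cls (LGen x).

Lemma lp_clsB u v : lp_cls (LBr u v) = [lie lp_cls u, lp_cls v].
Proof. exact: esym (lp_brE u v). Qed.

Lemma lp_ind (P : lie_pres -> Prop) :
  (forall x, P (lp_gen x)) -> P 0 -> (forall u v, P u -> P v -> P (u + v)) ->
  (forall (c : K) u, P u -> P (c *: u)) ->
  (forall u v, P u -> P v -> P [lie u, v]) -> forall u, P u.
Proof.
move=> Pg P0 PD PZ PB u; rewrite -(lp_clsE u); elim: (repr u).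
- exact: Pg.
- by rewrite lp_cls0.
- by move=> v Hv w Hw; rewrite lp_clsD; apply: PD.
- by move=> c v Hv; rewrite lp_clsZ; apply: PZ.
- by move=> v Hv w Hw; rewrite lp_clsB; apply: PB.
Qed.

Section Lift.
Variables (L : lieAlgType K) (f : X -> L).

Fixpoint lterm_eval (u : term) : L :=
  match u with
  | LGen x => f x
  | LZero => 0
  | LAdd u v => lterm_eval u + lterm_eval v
  | LScale c u => c *: lterm_eval u
  | LBr u v => [lie lterm_eval u, lterm_eval v]
  end.

Definition lp_lift (x : lie_pres) : L := lterm_eval (repr x).

(* lp_lift is meaningful only under this condition, which makes it the unique
   Lie algebra morphism sending lp_gen x to f x *)
Hypothesis f_rel : forall u v, rel u v -> lterm_eval u = lterm_eval v.

Lemma lterm_eval_eqv u v : lie_eqv u v -> lterm_eval u = lterm_eval v.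
Proof.
elim=> //=.
- by move=> v' u' w _ -> _ ->.
- by move=> u1 u2 v1 v2 _ -> _ ->.
- by move=> c u1 u2 _ ->.
- by move=> u1 u2 v1 v2 _ -> _ ->.
- by move=> *; rewrite addrA.
- by move=> *; rewrite addrC.
- by move=> *; rewrite add0r.
- by move=> *; rewrite scaleN1r addNr.
- by move=> *; rewrite scalerA.
- by move=> *; rewrite scale1r.
- by move=> *; rewrite scalerDr.
- by move=> *; rewrite scalerDl.
- by move=> *; rewrite lie_brDl.
- by move=> *; rewrite lie_brDr.
- by move=> *; rewrite lie_brZl.
- by move=> *; rewrite lie_brZr.
- by move=> *; rewrite lie_brxx.
- by move=> *; rewrite lie_jacobi.
Qed.

Lemma lp_lift_cls u : lp_lift (lp_cls u) = lterm_eval u.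
Proof. exact/lterm_eval_eqv/lp_repr. Qed.
Lemma lp_lift_gen x : lp_lift (lp_gen x) = f x.
Proof. exact: lp_lift_cls. Qed.
Lemma lp_liftD x y : lp_lift (x + y) = lp_lift x + lp_lift y.
Proof. by rewrite -(lp_clsE x) -(lp_clsE y) -lp_clsD !lp_lift_cls. Qed.
Lemma lp_liftZ c x : lp_lift (c *: x) = c *: lp_lift x.
Proof. by rewrite -(lp_clsE x) -lp_clsZ !lp_lift_cls. Qed.
Lemma lp_liftB x y : lp_lift [lie x, y] = [lie lp_lift x, lp_lift y].
Proof. by rewrite -(lp_clsE x) -(lp_clsE y) -lp_clsB !lp_lift_cls. Qed.

End Lift.
End Presentation.

(* The commutator subalgebra [L, L]: the linear span of all brackets (a scalar
   can be absorbed in either entry of a bracket). *)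
Section Derived.
Variables (K : fieldType) (L : lieAlgType K).

Definition lie_derived : {pred L} := fun x : L =>
  `[< exists s : seq (L * L), x = \sum_(q <- s) [lie q.1, q.2] >].

Lemma lie_derivedP x : reflect
  (exists s : seq (L * L), x = \sum_(q <- s) [lie q.1, q.2]) (x \in lie_derived).
Proof. exact: asboolP. Qed.

Lemma lie_derived_br x y : [lie x, y] \in lie_derived.
Proof. by apply/lie_derivedP; exists [:: (x, y)]; rewrite big_seq1. Qed.

Fact lie_derived_submod : submod_closed lie_derived.
Proof.
split; first by apply/lie_derivedP; exists [::]; rewrite big_nil.
move=> c x y /lie_derivedP[s ->] /lie_derivedP[t ->]; apply/lie_derivedP.
exists ([seq (c *: q.1, q.2) | q <- s] ++ t).
rewrite big_cat big_map scaler_sumr; congr (_ + _).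
by apply: eq_bigr => q _; rewrite lie_brZl.
Qed.

HB.instance Definition _ :=
  GRing.isSubmodClosed.Build K L lie_derived lie_derived_submod.

Record derived := Derived { derived_val : L; derived_valP : derived_val \in lie_derived }.

HB.instance Definition _ := [isSub for derived_val].
HB.instance Definition _ := [Choice of derived by <:].
HB.instance Definition _ := [SubChoice_isSubLmodule of derived by <:].

Definition derived_br (x y : derived) : derived :=
  Derived (lie_derived_br (val x) (val y)).

Fact derived_brDl x y z : derived_br (x + y) z = derived_br x z + derived_br y z.
Proof. by apply: val_inj; rewrite /= lie_brDl. Qed.
Fact derived_brDr x y z : derived_br x (y + z) = derived_br x y + derived_br x z.
Proof. by apply: val_inj; rewrite /= lie_brDr. Qed.
Fact derived_brZl (c : K) x y : derived_br (c *: x) y = c *: derived_br x y.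
Proof. by apply: val_inj; rewrite /= lie_brZl. Qed.
Fact derived_brZr (c : K) x y : derived_br x (c *: y) = c *: derived_br x y.
Proof. by apply: val_inj; rewrite /= lie_brZr. Qed.
Fact derived_brxx x : derived_br x x = 0.
Proof. by apply: val_inj; rewrite /= lie_brxx. Qed.
Fact derived_jacobi x y z : derived_br x (derived_br y z) +
  derived_br y (derived_br z x) + derived_br z (derived_br x y) = 0.
Proof. by apply: val_inj; rewrite /= lie_jacobi. Qed.

HB.instance Definition _ := isLieAlgebra.Build K derived
  derived_brDl derived_brDr derived_brZl derived_brZr derived_brxx derived_jacobi.

End Derived.

Section Abelianization.
Variables (K : fieldType) (L : lieAlgType K).
Local Open Scope quotient_scope.

(* the quotient vector space L / [L, L] *)
Definition lie_ab : Type := Quotient.quot (@lie_derived K L).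
HB.instance Definition _ := GRing.Zmodule.on lie_ab.

Definition ab_cls (x : L) : lie_ab := \pi_(Quotient.quot (@lie_derived K L)) x.

Lemma ab_clsE x y : (ab_cls x = ab_cls y) <-> (x - y \in @lie_derived K L).
Proof. by rewrite Quotient.idealrBE; split => /eqP. Qed.

Definition ab_scale (c : K) (x : lie_ab) : lie_ab := ab_cls (c *: repr x).

Lemma ab_scaleE c x : ab_scale c (ab_cls x) = ab_cls (c *: x).
Proof.
by apply/ab_clsE; rewrite -scalerBr rpredZ //; apply/ab_clsE; rewrite /ab_cls reprK.
Qed.

Lemma ab_reprK (x : lie_ab) : ab_cls (repr x) = x. Proof. exact: reprK. Qed.

Lemma ab_clsD x y : ab_cls (x + y) = ab_cls x + ab_cls y.
Proof. by rewrite /ab_cls !piE. Qed.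

Fact ab_scaleA a b x : ab_scale a (ab_scale b x) = ab_scale (a * b) x.
Proof. by rewrite -(ab_reprK x) !ab_scaleE scalerA. Qed.
Fact ab_scale1 : left_id 1 ab_scale.
Proof. by move=> x; rewrite -(ab_reprK x) ab_scaleE scale1r. Qed.
Fact ab_scaleDr : right_distributive ab_scale +%R.
Proof.
move=> a x y; rewrite -(ab_reprK x) -(ab_reprK y) -ab_clsD !ab_scaleE.
by rewrite scalerDr ab_clsD.
Qed.
Fact ab_scaleDl x : {morph ab_scale^~ x : a b / a + b}.
Proof. by move=> a b; rewrite -(ab_reprK x) !ab_scaleE scalerDl ab_clsD. Qed.

HB.instance Definition _ := GRing.Zmodule_isLmodule.Build K lie_ab
  ab_scaleA ab_scale1 ab_scaleDr ab_scaleDl.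

Fact ab_cls_linear : linear ab_cls.
Proof. by move=> c x y; rewrite ab_clsD -ab_scaleE. Qed.
HB.instance Definition _ := GRing.isLinear.Build K L lie_ab _ ab_cls ab_cls_linear.

Lemma ab_cls_surj (x : lie_ab) : exists y, x = ab_cls y.
Proof. by exists (repr x); rewrite ab_reprK. Qed.

Lemma ab_cls_eq0 x : (ab_cls x = 0) <-> (x \in @lie_derived K L).
Proof. by rewrite -(linear0 ab_cls) ab_clsE subr0. Qed.

End Abelianization.

Definition lie_morph (K : fieldType) (L M : lieAlgType K) (h : L -> M) : Prop :=
  [/\ forall x y, h (x + y) = h x + h y,
      forall (c : K) x, h (c *: x) = c *: h x
    & forall x y, h [lie x, y] = [lie h x, h y]].

Section LieMorph.
Variables (K : fieldType) (L M : lieAlgType K).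

Lemma lie_morph0 (h : L -> M) : lie_morph h -> h 0 = 0.
Proof. by case=> _ hZ _; rewrite -[in LHS](scale0r (0 : L)) hZ scale0r. Qed.

Lemma lie_morphN (h : L -> M) x : lie_morph h -> h (- x) = - h x.
Proof. by case=> _ hZ _; rewrite -scaleN1r hZ scaleN1r. Qed.

Lemma lie_morph_comp (N : lieAlgType K) (g : M -> N) (h : L -> M) :
  lie_morph g -> lie_morph h -> lie_morph (g \o h).
Proof.
case=> gD gZ gB [hD hZ hB]; split=> *; rewrite /=.
- by rewrite hD gD.
- by rewrite hZ gZ.
- by rewrite hB gB.
Qed.

Lemma lp_lift_morph X (rel : lterm K X -> lterm K X -> Prop) (f : X -> M) :
  (forall u v, rel u v -> lterm_eval f u = lterm_eval f v) ->
  lie_morph (lp_lift f : lie_pres rel -> M).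
Proof.
move=> fr; split=> *; [exact: lp_liftD|exact: lp_liftZ|exact: lp_liftB].
Qed.

End LieMorph.

Inductive f2_index := GenA | GenB.

Definition f2 (K : fieldType) : lieAlgType K :=
  lie_pres (fun _ _ : lterm K f2_index => False).

Section FreeLie2.
Variable K : fieldType.

Definition f2A : f2 K := lp_gen _ GenA.
Definition f2B : f2 K := lp_gen _ GenB.

(* psi(x, y) *)
Definition f2_ev (L : lieAlgType K) (psi : f2 K) (x y : L) : L :=
  lp_lift (fun g => if g is GenA then x else y) psi.

Lemma f2_ev_morph (L : lieAlgType K) (x y : L) :
  lie_morph (fun psi => f2_ev psi x y).
Proof. exact: lp_lift_morph. Qed.
Lemma f2_evA (L : lieAlgType K) (x y : L) : f2_ev f2A x y = x.
Proof. exact: lp_lift_gen. Qed.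
Lemma f2_evB (L : lieAlgType K) (x y : L) : f2_ev f2B x y = y.
Proof. exact: lp_lift_gen. Qed.

Lemma f2_ind (P : f2 K -> Prop) :
  P f2A -> P f2B -> P 0 -> (forall u v, P u -> P v -> P (u + v)) ->
  (forall (c : K) u, P u -> P (c *: u)) ->
  (forall u v, P u -> P v -> P [lie u, v]) -> forall u, P u.
Proof. by move=> PA PB; apply: lp_ind => -[]. Qed.

(* f2_homog n psi: psi lies in the component of degree n for the grading of the
   free Lie algebra with deg A = deg B = 1. *)
Inductive f2_homog : nat -> f2 K -> Prop :=
| f2_homogA : f2_homog 1 f2A
| f2_homogB : f2_homog 1 f2B
| f2_homog0 n : f2_homog n 0
| f2_homogD n x y : f2_homog n x -> f2_homog n y -> f2_homog n (x + y)
| f2_homogZ n (c : K) x : f2_homog n x -> f2_homog n (c *: x)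
| f2_homog_br m n x y : f2_homog m x -> f2_homog n y -> f2_homog (m + n) [lie x, y].

End FreeLie2.
Arguments f2A {K}.
Arguments f2B {K}.

Definition t_index (n : nat) := {ij : 'I_n * 'I_n | ij.1 != ij.2}.

Section InfBraids.
Variable K : fieldType.

(* junk value LZero when i = j *)
Definition t_term n (i j : 'I_n) : lterm K (t_index n) :=
  if insub (i, j) is Some ij then LGen ij else LZero.

Inductive t_rel n : lterm K (t_index n) -> lterm K (t_index n) -> Prop :=
| t_rel_sym i j : i != j -> t_rel (t_term i j) (t_term j i)
| t_rel_tri i j k : uniq [:: i; j; k] ->
    t_rel (LBr (LAdd (t_term i j) (t_term i k)) (t_term j k)) LZero
| t_rel_com i j k l : uniq [:: i; j; k; l] ->
    t_rel (LBr (t_term i j) (t_term k l)) LZero.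

Definition t_lie n : lieAlgType K := lie_pres (@t_rel n).

Definition t_gen n (i j : 'I_n) : t_lie n := lp_cls (@t_rel n) (t_term i j).

Lemma t_gen_sym n (i j : 'I_n) : i != j -> t_gen i j = t_gen j i.
Proof. by move=> ij; apply/lp_clsP/lie_eqv_rel/t_rel_sym. Qed.
Lemma t_gen_tri n (i j k : 'I_n) : uniq [:: i; j; k] ->
  [lie t_gen i j + t_gen i k, t_gen j k] = 0.
Proof.
by move=> u; rewrite -lp_clsD -lp_clsB; apply/lp_clsP/lie_eqv_rel/t_rel_tri.
Qed.
Lemma t_gen_com n (i j k l : 'I_n) : uniq [:: i; j; k; l] ->
  [lie t_gen i j, t_gen k l] = 0.
Proof. by move=> u; rewrite -lp_clsB; apply/lp_clsP/lie_eqv_rel/t_rel_com. Qed.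

(* psi^{I_1,...,I_n}; a Lie algebra morphism only for pairwise disjoint I_i
   (t_ins_morph) *)
Definition t_ins n m (I : 'I_n -> {set 'I_m}) (psi : t_lie n) : t_lie m :=
  lp_lift (fun ij : t_index n =>
    \sum_(a in I (val ij).1) \sum_(b in I (val ij).2) t_gen a b) psi.

Section InsMorph.
Variables (n m : nat) (I : 'I_n -> {set 'I_m}).
Hypothesis dI : forall i j, i != j -> [disjoint I i & I j].
Local Notation T i j := (\sum_(a in I i) \sum_(b in I j) t_gen a b).

Lemma t_ins_eval i j : i != j ->
  lterm_eval (fun ij : t_index n => T (val ij).1 (val ij).2) (t_term i j) = T i j.
Proof. by move=> ij; rewrite /t_term insubT. Qed.

Lemma t_ins_neq i j a b : i != j -> a \in I i -> b \in I j -> a != b.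
Proof.
move=> /dI; rewrite disjoint_subset => /subsetP h /h; rewrite inE => aj bj.
by apply: contraNneq aj => ->.
Qed.

Lemma t_ins_rel u v : t_rel u v ->
  lterm_eval (fun ij : t_index n => T (val ij).1 (val ij).2) u =
  lterm_eval (fun ij : t_index n => T (val ij).1 (val ij).2) v.
Proof.
case=> {u v} [i j ij|i j k|i j k l] /=.
- rewrite !t_ins_eval // 1?eq_sym // exchange_big /=.
  apply: eq_bigr => b bj; apply: eq_bigr => a ai.
  by apply: t_gen_sym; apply: (t_ins_neq ij).
- rewrite !inE negb_or => /and3P[/andP[ij ik] jk _]; rewrite !t_ins_eval //.
  rewrite lie_br_sumr big1 // => b bj; rewrite lie_br_sumr big1 // => c ck.
  rewrite -big_split /= lie_br_suml big1 // => a ai.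
  have ab := t_ins_neq ij ai bj; have ac := t_ins_neq ik ai ck.
  have bc := t_ins_neq jk bj ck.
  rewrite (bigD1 b) //= [in X in _ + X](bigD1 c) //= addrACA lie_brDl t_gen_tri;
    last by rewrite /= !inE negb_or ab ac bc.
  rewrite add0r lie_brDl !lie_br_suml !big1 ?addr0 // => d /andP[dI' dn].
  + have ad := t_ins_neq ik ai dI'; have bd := t_ins_neq jk bj dI'.
    by rewrite t_gen_com //= !inE !negb_or ad ab ac eq_sym bd dn bc.
  + have ad := t_ins_neq ij ai dI'; have dc := t_ins_neq jk dI' ck.
    by rewrite t_gen_com //= !inE !negb_or ad ab ac dn dc bc.
- rewrite !inE !negb_or => /and4P[/and3P[ij ik il] /andP[jk jl] kl _].
  rewrite !t_ins_eval //.
  rewrite lie_br_suml big1 // => a ai; rewrite lie_br_suml big1 // => b bj.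
  rewrite lie_br_sumr big1 // => c ck; rewrite lie_br_sumr big1 // => d dl.
  apply: t_gen_com; rewrite /= !inE !negb_or.
  rewrite (t_ins_neq ij ai bj) (t_ins_neq ik ai ck) (t_ins_neq il ai dl).
  by rewrite (t_ins_neq jk bj ck) (t_ins_neq jl bj dl) (t_ins_neq kl ck dl).
Qed.

Lemma t_ins_morph : lie_morph (t_ins I).
Proof. exact: lp_lift_morph t_ins_rel. Qed.

Lemma t_ins_gen i j : i != j -> t_ins I (t_gen i j) = T i j.
Proof.
by move=> ij; rewrite /t_ins lp_lift_cls ?t_ins_eval //; apply: t_ins_rel.
Qed.

End InsMorph.
End InfBraids.
Arguments t_gen {K n}.

(* lbl k is the index labelled k when the labels run from 1 *)
Definition lbl {n} (k : nat) : 'I_n.+1 := inord k.-1.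

Definition ins3 {n} (I1 I2 I3 : {set 'I_n}) : 'I_3 -> {set 'I_n} :=
  fun i => nth set0 [:: I1; I2; I3] i.

Section Grt.
Variable K : fieldType.

(* the inclusion of f_2 in t_3 given by A = t_12, B = t_23 *)
Definition f2_t3 (psi : f2 K) : t_lie K 3 :=
  f2_ev psi (t_gen (lbl 1) (lbl 2)) (t_gen (lbl 2) (lbl 3)).

(* psi^{I1,I2,I3} in t_4 *)
Definition f2_ins (I1 I2 I3 : {set 'I_4}) (psi : f2 K) : t_lie K 4 :=
  t_ins (ins3 I1 I2 I3) (f2_t3 psi).

Record grt1 (psi : f2 K) : Prop := Grt1 {
  grt1_antisym : f2_ev psi f2B f2A = - f2_ev psi f2A f2B;
  grt1_hexagon : let f2C := - f2A - f2B in
    f2_ev psi f2A f2B + f2_ev psi f2B f2C + f2_ev psi f2C f2A = 0;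
  grt1_pentagon :
    f2_ins [set lbl 1; lbl 2] [set lbl 3] [set lbl 4] psi
    - f2_ins [set lbl 1] [set lbl 2; lbl 3] [set lbl 4] psi
    + f2_ins [set lbl 1] [set lbl 2] [set lbl 3; lbl 4] psi
    = f2_ins [set lbl 2] [set lbl 3] [set lbl 4] psi
    + f2_ins [set lbl 1] [set lbl 2] [set lbl 3] psi
}.

End Grt.

(* A metabelian Lie algebra k^2 + k[a, b]: (x, y, f) stands for x A + y B plus
   an element of the derived algebra whose image under i is f. *)
Section Metabelian.
Variable K : fieldType.
Local Notation P := {mpoly K[2]}.

Definition Abar : P := 'X_(0 : 'I_2).
Definition Bbar : P := 'X_(1 : 'I_2).

Definition metab : Type := (K^o * K^o * P)%type.
HB.instance Definition _ := GRing.Lmodule.on metab.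

Definition metab_br (u v : metab) : metab :=
  (0, 0, (u.1.1 * v.1.2 - u.1.2 * v.1.1)%:MP * (Abar * Bbar)
         + (u.1.1%:MP * Abar + u.1.2%:MP * Bbar) * v.2
         - (v.1.1%:MP * Abar + v.1.2%:MP * Bbar) * u.2).

Fact metab_brDl x y z : metab_br (x + y) z = metab_br x z + metab_br y z.
Proof.
case: x y z => [[x1 x2] x] [[y1 y2] y] [[z1 z2] z].
congr (_, _, _); rewrite /= ?addr0 //.
by rewrite ?(mpolyCB, mpolyCD, mpolyCM); ring.
Qed.
Fact metab_brDr x y z : metab_br x (y + z) = metab_br x y + metab_br x z.
Proof.
case: x y z => [[x1 x2] x] [[y1 y2] y] [[z1 z2] z].
congr (_, _, _); rewrite /= ?addr0 //.
by rewrite ?(mpolyCB, mpolyCD, mpolyCM); ring.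
Qed.
Fact metab_brZl (c : K) x y : metab_br (c *: x) y = c *: metab_br x y.
Proof.
case: x y => [[x1 x2] x] [[y1 y2] y].
congr (_, _, _); rewrite /= ?scaler0 // -!mul_mpolyC.
by rewrite /GRing.scale /= ?(mpolyCB, mpolyCD, mpolyCM); ring.
Qed.
Fact metab_brZr (c : K) x y : metab_br x (c *: y) = c *: metab_br x y.
Proof.
case: x y => [[x1 x2] x] [[y1 y2] y].
congr (_, _, _); rewrite /= ?scaler0 // -!mul_mpolyC.
by rewrite /GRing.scale /= ?(mpolyCB, mpolyCD, mpolyCM); ring.
Qed.
Fact metab_brxx x : metab_br x x = 0.
Proof.
case: x => [[x1 x2] x]; congr (_, _, _) => /=.
by rewrite ?(mpolyCB, mpolyCD, mpolyCM); ring.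
Qed.
Fact metab_jacobi x y z : metab_br x (metab_br y z) + metab_br y (metab_br z x)
  + metab_br z (metab_br x y) = 0.
Proof.
case: x y z => [[x1 x2] x] [[y1 y2] y] [[z1 z2] z].
congr (_, _, _) => /=; rewrite ?addr0 //.
by rewrite ?(mpolyCB, mpolyCD, mpolyCM, mpolyC0, mulr0, mul0r); ring.
Qed.
HB.instance Definition _ := isLieAlgebra.Build K metab
  metab_brDl metab_brDr metab_brZl metab_brZr metab_brxx metab_jacobi.

End Metabelian.

Section LinearPart.
Variable K : fieldType.

Definition f2_metab (x : f2 K) : metab K :=
  f2_ev x ((1, 0, 0) : metab K) ((0, 1, 0) : metab K).

Lemma f2_metab_morph : lie_morph f2_metab.
Proof. exact: f2_ev_morph. Qed.

Definition f2_cA (x : f2 K) : K := (f2_metab x).1.1.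
Definition f2_cB (x : f2 K) : K := (f2_metab x).1.2.

Lemma f2_cAA : f2_cA f2A = 1. Proof. by rewrite /f2_cA /f2_metab f2_evA. Qed.
Lemma f2_cAB : f2_cA f2B = 0. Proof. by rewrite /f2_cA /f2_metab f2_evB. Qed.
Lemma f2_cBA : f2_cB f2A = 0. Proof. by rewrite /f2_cB /f2_metab f2_evA. Qed.
Lemma f2_cBB : f2_cB f2B = 1. Proof. by rewrite /f2_cB /f2_metab f2_evB. Qed.
Lemma f2_cAD x y : f2_cA (x + y) = f2_cA x + f2_cA y.
Proof. by rewrite /f2_cA; case: f2_metab_morph => -> _ _. Qed.
Lemma f2_cBD x y : f2_cB (x + y) = f2_cB x + f2_cB y.
Proof. by rewrite /f2_cB; case: f2_metab_morph => -> _ _. Qed.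
Lemma f2_cAZ c x : f2_cA (c *: x) = c * f2_cA x.
Proof. by rewrite /f2_cA; case: f2_metab_morph => _ -> _. Qed.
Lemma f2_cBZ c x : f2_cB (c *: x) = c * f2_cB x.
Proof. by rewrite /f2_cB; case: f2_metab_morph => _ -> _. Qed.
Lemma f2_cAbr x y : f2_cA [lie x, y] = 0.
Proof. by rewrite /f2_cA; case: f2_metab_morph => _ _ ->. Qed.
Lemma f2_cBbr x y : f2_cB [lie x, y] = 0.
Proof. by rewrite /f2_cB; case: f2_metab_morph => _ _ ->. Qed.
Lemma f2_cA0 : f2_cA 0 = 0.
Proof. by rewrite -[X in f2_cA X](scale0r (0 : f2 K)) f2_cAZ mul0r. Qed.
Lemma f2_cB0 : f2_cB 0 = 0.
Proof. by rewrite -[X in f2_cB X](scale0r (0 : f2 K)) f2_cBZ mul0r. Qed.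

Lemma f2_metab_lin (h : f2 K -> metab K) (x : f2 K) : lie_morph h ->
  (h x).1.1 = f2_cA x * (h f2A).1.1 + f2_cB x * (h f2B).1.1.
Proof.
move=> hm; have [hD hZ hB] := hm; elim/f2_ind: x.
- by rewrite f2_cAA f2_cBA mul1r mul0r addr0.
- by rewrite f2_cAB f2_cBB mul1r mul0r add0r.
- by rewrite f2_cA0 f2_cB0 !mul0r addr0 lie_morph0.
- by move=> u v Hu Hv; rewrite hD f2_cAD f2_cBD /= Hu Hv; ring.
- by move=> c u Hu; rewrite hZ f2_cAZ f2_cBZ /= Hu /GRing.scale /=; ring.
- by move=> u v _ _; rewrite hB f2_cAbr f2_cBbr !mul0r addr0.
Qed.

Lemma f2_decomp (x : f2 K) :
  x - (f2_cA x *: f2A + f2_cB x *: f2B) \in @lie_derived K (f2 K).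
Proof.
elim/f2_ind: x.
- by rewrite f2_cAA f2_cBA scale1r scale0r addr0 subrr rpred0.
- by rewrite f2_cAB f2_cBB scale1r scale0r add0r subrr rpred0.
- by rewrite f2_cA0 f2_cB0 !scale0r addr0 subrr rpred0.
- move=> u v Hu Hv; rewrite f2_cAD f2_cBD !scalerDl.
  by rewrite [X in _ - X]addrACA opprD addrACA rpredD.
- move=> c u Hu; rewrite f2_cAZ f2_cBZ -!scalerA -scalerDr -scalerBr.
  exact: rpredZ.
- move=> u v _ _; rewrite f2_cAbr f2_cBbr !scale0r addr0 subr0.
  exact: lie_derived_br.
Qed.

Let w n (i j : 'I_n) : bool :=
  ((i == 0%N :> nat) && (j == 1%N :> nat)) || ((i == 1%N :> nat) && (j == 0%N :> nat)).

Let chi (x : t_lie K 4) : metab K :=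
  lp_lift (fun ij : t_index 4 => ((w (val ij).1 (val ij).2)%:R, 0, 0) : metab K) x.

Let chi_term (i j : 'I_4) :
  lterm_eval (fun ij : t_index 4 => ((w (val ij).1 (val ij).2)%:R, 0, 0) : metab K)
    (t_term K i j) = ((w i j)%:R, 0, 0).
Proof.
rewrite /t_term; case: insubP => [u _ eu|].
  by rewrite -[LHS]/(((w (\val u).1 (\val u).2)%:R, 0, 0) : metab K) eu.
rewrite /= negbK => /eqP ->.
by case: j => [[|[|j]] ?].
Qed.

Let chi_rel u v : t_rel u v ->
  lterm_eval (fun ij : t_index 4 => ((w (val ij).1 (val ij).2)%:R, 0, 0) : metab K) u =
  lterm_eval (fun ij : t_index 4 => ((w (val ij).1 (val ij).2)%:R, 0, 0) : metab K) v.
Proof.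
have brE (a b : K) : [lie ((a, 0, 0) : metab K), ((b, 0, 0) : metab K)] = 0.
  congr (_, _, _) => /=.
  by rewrite ?(mpolyCB, mpolyCD, mpolyCM, mpolyC0, mulr0, mul0r, subrr, addr0).
case=> [i j ij|i j k _|i j k l _]; rewrite /= !chi_term //.
- by rewrite /w orbC [in X in X || _]andbC [in X in _ || X]andbC.
- by rewrite -[_ + _]/((_, 0 + 0, 0 + 0) : metab K) !addr0 brE.
Qed.

Let chi_morph : lie_morph chi.
Proof. exact: lp_lift_morph chi_rel. Qed.

Let chi_gen i j : (chi (t_gen i j)).1.1 = (w i j)%:R.
Proof. by rewrite /chi lp_lift_cls ?chi_term //; apply: chi_rel. Qed.

Let chi_sum I (r : seq I) (P : pred I) (F : I -> t_lie K 4) :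
  (chi (\sum_(i <- r | P i) F i)).1.1 = \sum_(i <- r | P i) (chi (F i)).1.1.
Proof.
apply: (big_morph (fun x => (chi x).1.1)) => [x y|].
  by case: chi_morph => -> _ _.
by rewrite lie_morph0.
Qed.

Let chi_ins (I1 I2 I3 : {set 'I_4}) (psi : f2 K) :
  [disjoint I1 & I2] -> [disjoint I1 & I3] -> [disjoint I2 & I3] ->
  (chi (f2_ins I1 I2 I3 psi)).1.1 =
    f2_cA psi * (\sum_(a in I1) \sum_(b in I2) (w a b)%:R) +
    f2_cB psi * (\sum_(a in I2) \sum_(b in I3) (w a b)%:R).
Proof.
move=> d12 d13 d23.
have dI i j : i != j -> [disjoint ins3 I1 I2 I3 i & ins3 I1 I2 I3 j].
  by case: i j => [[|[|[|?]]] ?] [[|[|[|?]]] ?] //= _; rewrite /ins3 //= disjoint_sym.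
have hm : lie_morph (fun x => chi (f2_ins I1 I2 I3 x)).
  apply: (lie_morph_comp chi_morph (h := f2_ins I1 I2 I3)).
  exact: (lie_morph_comp (t_ins_morph K dI) (f2_ev_morph _ _)).
rewrite (f2_metab_lin psi hm) /f2_ins /f2_t3 f2_evA f2_evB.
have lneq (i j : nat) : (0 < i <= 3)%N -> (0 < j <= 3)%N -> i != j ->
    (lbl i : 'I_3) != lbl j.
  move=> /andP[i0 i3] /andP[j0 j3]; rewrite -val_eqE /= !inordK ?prednK //.
  by rewrite -[X in _ -> ~~ X]eqSS !prednK.
rewrite !(t_ins_gen K dI) ?lneq // /ins3 /lbl !inordK //= !chi_sum.
by congr (_ * _ + _ * _); apply: eq_bigr => a _; rewrite chi_sum;
  apply: eq_bigr => b _; rewrite chi_gen.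
Qed.

Lemma grt1_derived (psi : f2 K) : grt1 psi -> psi \in @lie_derived K (f2 K).
Proof.
case=> anti _ penta.
have lblE (k : nat) (lk : (k < 4)%N) : lbl k.+1 = Ordinal lk.
  by apply: val_inj; rewrite /= inordK.
have cA0 : f2_cA psi = 0.
  have := congr1 (fun x => (chi x).1.1) penta => /=.
  have cD x y : (chi (x + y)).1.1 = (chi x).1.1 + (chi y).1.1.
    by case: chi_morph => -> _ _.
  have cN x : (chi (- x)).1.1 = - (chi x).1.1 by rewrite lie_morphN.
  rewrite !cD cN !chi_ins; first last.
  all: try by rewrite ?(lblE 0 isT, lblE 1 isT, lblE 2 isT, lblE 3 isT) disjoint_subset;
    apply/subsetP => x; rewrite !inE -!val_eqE /=; case: x => [[|[|[|[|?]]]] ?].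
  rewrite ?(lblE 0%N isT, lblE 1%N isT, lblE 2%N isT, lblE 3%N isT).
  have sU (F : 'I_4 -> K) (a b : 'I_4) : a != b ->
      \sum_(x in [set a; b]) F x = F a + F b.
    by move=> ab; rewrite big_setU1 ?inE // big_set1.
  rewrite !(sU, big_set1) // /w /= ?mulr0 ?mulr1 ?(add0r, addr0, subr0).
  by rewrite ?(add0r, addr0, oppr0, mulr0, mulr1) addNr => /esym.
have := congr1 (fun x => (f2_metab x).1.1) anti => /=.
rewrite lie_morphN; last exact: f2_metab_morph.
have mor x y : lie_morph (fun u => f2_metab (f2_ev u x y)).
  exact: (lie_morph_comp f2_metab_morph (f2_ev_morph x y)).
rewrite /= (f2_metab_lin psi (mor f2B f2A)) (f2_metab_lin psi (mor f2A f2B)).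
rewrite !f2_evA !f2_evB -!/(f2_cA _) f2_cAA f2_cAB cA0.
rewrite !(mulr0, mul0r, add0r, mulr1, oppr0) => cB0.
by have := f2_decomp psi; rewrite cA0 cB0 !scale0r addr0 subr0.
Qed.

End LinearPart.

Section PAb.
Variable K : fieldType.
Local Notation P := {mpoly K[2]}.
Local Notation p := (derived (f2 K)).
Local Notation pab := (lie_ab p).

Definition p_word (k l : nat) : f2 K :=
  iter k.-1 (lie_br f2A) (iter l.-1 (lie_br f2B) [lie f2A, f2B]).

Fact p_word_derived k l : p_word k l \in @lie_derived K (f2 K).
Proof.
rewrite /p_word; case: k.-1 => [|k'] /=; last exact: lie_derived_br.
by case: l.-1 => [|l'] /=; apply: lie_derived_br.
Qed.

(* p_{kl}; only used for k, l >= 1 *)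
Definition p_cls (k l : nat) : pab := ab_cls (Derived (p_word_derived k l)).

Definition pab_ad (x : f2 K) (c : pab) : pab :=
  ab_cls (Derived (lie_derived_br x (val (repr c)))).

Let val_sum I (r : seq I) (Q : pred I) (F : I -> p) :
  derived_val (\sum_(i <- r | Q i) F i) = \sum_(i <- r | Q i) derived_val (F i).
Proof. by apply: (big_morph (@derived_val K (f2 K))). Qed.

Lemma pab_adE x (z : p) :
  pab_ad x (ab_cls z) = ab_cls (Derived (lie_derived_br x (val z))).
Proof.
apply/ab_clsE; have : repr (ab_cls z) - z \in @lie_derived K p.
  by apply/ab_clsE; rewrite ab_reprK.
set u := repr _ => /lie_derivedP[s us].
have -> : Derived (lie_derived_br x (val u)) - Derived (lie_derived_br x (val z)) =
    Derived (lie_derived_br x (val (u - z))).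
  by apply: val_inj; rewrite /= lie_brDr lie_brNr.
rewrite us.
have -> : Derived (lie_derived_br x (val (\sum_(q <- s) [lie q.1, q.2]))) =
    \sum_(q <- s) ([lie q.1, Derived (lie_derived_br x (val q.2))] +
                   [lie Derived (lie_derived_br x (val q.1)), q.2]).
  apply: val_inj; rewrite /= !val_sum /= lie_br_sumr.
  by apply: eq_bigr => q _; rewrite /= lie_adD.
by apply: rpred_sum => q _; rewrite rpredD ?lie_derived_br.
Qed.

Lemma pab_adD x c d : pab_ad x (c + d) = pab_ad x c + pab_ad x d.
Proof.
rewrite -(ab_reprK c) -(ab_reprK d) -ab_clsD !pab_adE -ab_clsD; congr ab_cls.
by apply: val_inj; rewrite /= lie_brDr.
Qed.
Lemma pab_adZ x (a : K) c : pab_ad x (a *: c) = a *: pab_ad x c.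
Proof.
rewrite -(ab_reprK c) -linearZ !pab_adE -linearZ; congr ab_cls.
by apply: val_inj; rewrite /= lie_brZr.
Qed.
Lemma pab_ad0 x : pab_ad x 0 = 0.
Proof. by rewrite -[X in pab_ad _ X](scale0r (0 : pab)) pab_adZ scale0r. Qed.
Lemma pab_adC x y c : pab_ad x (pab_ad y c) = pab_ad y (pab_ad x c).
Proof.
rewrite -(ab_reprK c) (pab_adE x (repr c)) (pab_adE y (repr c)) !pab_adE.
apply/ab_clsE; set z := repr c.
rewrite (_ : _ - _ = [lie Derived (lie_derived_br x y), z]) ?lie_derived_br //.
by apply: val_inj; rewrite /= [X in X - _]lie_adD addrAC subrr add0r.
Qed.

Lemma pab_adA_cls k l : pab_ad f2A (p_cls k.+1 l) = p_cls k.+2 l.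
Proof. by rewrite pab_adE; congr ab_cls; apply: val_inj. Qed.
Lemma pab_adB_cls k l : pab_ad f2B (p_cls k.+1 l.+1) = p_cls k.+1 l.+2.
Proof.
elim: k => [|k IH]; last by rewrite -!pab_adA_cls pab_adC IH.
by rewrite pab_adE; congr ab_cls; apply: val_inj.
Qed.

Inductive p_span : pab -> Prop :=
| p_span_cls k l : p_span (p_cls k.+1 l.+1)
| p_span0 : p_span 0
| p_spanD c d : p_span c -> p_span d -> p_span (c + d)
| p_spanZ (a : K) c : p_span c -> p_span (a *: c).

Lemma p_span_adA c : p_span c -> p_span (pab_ad f2A c).
Proof.
elim=> [k l||u v _ Hu _ Hv|a u _ Hu].
- by rewrite pab_adA_cls; apply: p_span_cls.
- by rewrite pab_ad0; apply: p_span0.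
- by rewrite pab_adD; apply: p_spanD.
- by rewrite pab_adZ; apply: p_spanZ.
Qed.
Lemma p_span_adB c : p_span c -> p_span (pab_ad f2B c).
Proof.
elim=> [k l||u v _ Hu _ Hv|a u _ Hu].
- by rewrite pab_adB_cls; apply: p_span_cls.
- by rewrite pab_ad0; apply: p_span0.
- by rewrite pab_adD; apply: p_spanD.
- by rewrite pab_adZ; apply: p_spanZ.
Qed.

Let lin (a b : K) : f2 K := a *: f2A + b *: f2B.
Let rest (x : f2 K) : p := Derived (f2_decomp x).

Let p_span_lin a b c : p_span c -> p_span (pab_ad (lin a b) c).
Proof.
move=> Hc.
have -> : pab_ad (lin a b) c = a *: pab_ad f2A c + b *: pab_ad f2B c.
  rewrite -(ab_reprK c) !pab_adE -!linearZ -ab_clsD; congr ab_cls.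
  by apply: val_inj; rewrite /= lie_brDl !lie_brZl.
by apply: p_spanD; apply: p_spanZ; [apply: p_span_adA|apply: p_span_adB].
Qed.

Let lin_br a b c d (x y : f2 K) :
  [lie lin a b + x, lin c d + y] -
  ((a * d - b * c) *: [lie f2A, f2B] + [lie lin a b, y] - [lie lin c d, x]) =
  [lie x, y].
Proof.
have -> : (a * d - b * c) *: [lie f2A, f2B] = [lie lin a b, lin c d].
  rewrite lie_brDl !lie_brDr !lie_brZl !lie_brZr !lie_brxx !scaler0 add0r addr0.
  by rewrite (lie_brC f2B f2A) !scalerN !scalerA scalerBl.
rewrite (lie_brDl (lin a b)) (lie_brDr (lin a b)) (lie_brDr x) (lie_brC x (lin c d)).
by apply/eqP; rewrite subr_eq addrA [eqbRHS]addrC.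
Qed.

Let p_span_rest x : p_span (ab_cls (rest x)).
Proof.
elim/f2_ind: x.
- rewrite (_ : rest _ = 0) ?linear0; first exact: p_span0.
  by apply: val_inj; rewrite /= f2_cAA f2_cBA scale1r scale0r addr0 subrr.
- rewrite (_ : rest _ = 0) ?linear0; first exact: p_span0.
  by apply: val_inj; rewrite /= f2_cAB f2_cBB scale1r scale0r add0r subrr.
- rewrite (_ : rest _ = 0) ?linear0; first exact: p_span0.
  by apply: val_inj; rewrite /= f2_cA0 f2_cB0 !scale0r addr0 subrr.
- move=> u v Hu Hv; rewrite (_ : rest _ = rest u + rest v).
    by rewrite ab_clsD; apply: p_spanD.
  apply: val_inj; rewrite /= f2_cAD f2_cBD !scalerDl.
  by rewrite [X in _ - X]addrACA opprD addrACA.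
- move=> c u Hu; rewrite (_ : rest _ = c *: rest u).
    by rewrite linearZ; apply: p_spanZ.
  by apply: val_inj; rewrite /= f2_cAZ f2_cBZ -!scalerA -scalerDr -scalerBr.
move=> u v Hu Hv.
have split_rest (x : f2 K) : x = lin (f2_cA x) (f2_cB x) + val (rest x).
  by rewrite /= addrC subrK.
have -> : ab_cls (rest [lie u, v]) =
    (f2_cA u * f2_cB v - f2_cB u * f2_cA v) *: p_cls 1 1
    + pab_ad (lin (f2_cA u) (f2_cB u)) (ab_cls (rest v))
    - pab_ad (lin (f2_cA v) (f2_cB v)) (ab_cls (rest u)).
  rewrite !pab_adE -linearZ -ab_clsD -linearB; apply/ab_clsE.
  rewrite (_ : _ - _ = [lie rest u, rest v]) ?lie_derived_br //.
  apply: val_inj; rewrite [LHS]/=.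
  rewrite f2_cAbr f2_cBbr !scale0r addr0 subr0.
  by rewrite -[RHS](lin_br (f2_cA u) (f2_cB u) (f2_cA v) (f2_cB v)) -!split_rest.
apply: p_spanD; first apply: p_spanD.
- exact/p_spanZ/p_span_cls.
- exact: p_span_lin.
- by rewrite -scaleN1r; apply/p_spanZ/p_span_lin.
Qed.

Lemma pab_ind (Q : pab -> Prop) :
  (forall k l, Q (p_cls k.+1 l.+1)) -> Q 0 ->
  (forall c d, Q c -> Q d -> Q (c + d)) ->
  (forall (a : K) c, Q c -> Q (a *: c)) -> forall c, Q c.
Proof.
move=> Qp Q0 QD QZ c; suff : p_span c.
  by elim=> *; [exact: Qp|exact: Q0|exact: QD|exact: QZ].
have [z ->] := ab_cls_surj c; case: z => x xd.
have := p_span_rest x.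
have [a0 b0] : f2_cA x = 0 /\ f2_cB x = 0.
  case/lie_derivedP: xd => s ->; elim: s => [|q s [IHa IHb]].
    by rewrite big_nil f2_cA0 f2_cB0.
  by rewrite big_cons f2_cAD f2_cBD IHa IHb f2_cAbr f2_cBbr !addr0.
rewrite (_ : rest x = Derived xd) //; apply: val_inj.
by rewrite /= a0 b0 !scale0r addr0 subr0.
Qed.

Let metab_derived (z : p) : (f2_metab (val z)).1 = 0.
Proof.
have [hD hZ hB] := @f2_metab_morph K.
case: z => x /= /lie_derivedP[s ->]; elim: s => [|q s IH].
  by rewrite big_nil lie_morph0 //; apply: f2_metab_morph.
by rewrite big_cons hD /= IH addr0 hB.
Qed.

Let ibar_fun (c : pab) : P := (f2_metab (val (repr c))).2.

Let ibar_funE (z : p) : ibar_fun (ab_cls z) = (f2_metab (val z)).2.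
Proof.
have hm := @f2_metab_morph K; have [hD hZ hB] := hm.
rewrite /ibar_fun; set u := repr _.
have : u - z \in @lie_derived K p by apply/ab_clsE; rewrite ab_reprK.
move=> /lie_derivedP[s us].
apply/eqP; rewrite -subr_eq0.
have -> : (f2_metab (val u)).2 - (f2_metab (val z)).2 = (f2_metab (val (u - z))).2.
  by rewrite /= hD lie_morphN.
rewrite us; elim: s {us} => [|q s IH].
  by rewrite big_nil /= lie_morph0.
rewrite big_cons /= hD /= (eqP IH) addr0 hB /= !metab_derived.
by rewrite ?(mulr0, subrr, mpolyC0, mul0r, addr0).
Qed.

Let ibar_fun_linear : linear ibar_fun.
Proof.
have [hD hZ hB] := @f2_metab_morph K.
move=> a c d; rewrite -(ab_reprK c) -(ab_reprK d) -linearZ -ab_clsD !ibar_funE.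
by rewrite /= hD hZ.
Qed.

Lemma ibar_exists : exists i : {linear pab -> P},
  forall k l, (0 < k)%N -> (0 < l)%N -> i (p_cls k l) = Abar K ^+ k * Bbar K ^+ l.
Proof.
pose L := GRing.isLinear.Build K pab P _ ibar_fun ibar_fun_linear.
pose i : {linear pab -> P} := HB.pack ibar_fun L.
exists i => -[//|k] [//|l] _ _; rewrite /= ibar_funE /= /p_word /=.
have [hD hZ hB] := @f2_metab_morph K.
have hA : f2_metab (K := K) f2A = (1, 0, 0) by apply: f2_evA.
have hBb : f2_metab (K := K) f2B = (0, 1, 0) by apply: f2_evB.
have -> : f2_metab (iter k (lie_br f2A) (iter l (lie_br f2B) [lie f2A, f2B])) =
   (0, 0, Abar K ^+ k.+1 * Bbar K ^+ l.+1) :> metab K.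
  elim: k => [|k IH] /=.
    elim: l => [|l IH] /=.
      rewrite hB hA hBb; congr (_, _, _) => /=.
      by rewrite !(mulr1, mulr0, subr0, addr0) mpolyC1 mul1r !expr1.
    rewrite hB IH hBb; congr (_, _, _) => /=.
    by rewrite ?(mulr1, mulr0, subr0, mpolyC0, mpolyC1) !exprS; ring.
  rewrite hB IH hA; congr (_, _, _) => /=.
  by rewrite ?(mulr1, mulr0, subr0, mpolyC0, mpolyC1) !exprS; ring.
by [].
Qed.

(* The linear map i: ibarE and ibar_uniq characterize it, and by ibar_inj and
   ibar_image it is an isomorphism onto the ideal generated by Abar Bbar. *)
Definition ibar : {linear pab -> P} := projT1 (cid ibar_exists).

Lemma ibarE k l : (0 < k)%N -> (0 < l)%N ->
  ibar (p_cls k l) = Abar K ^+ k * Bbar K ^+ l.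
Proof. exact: (projT2 (cid ibar_exists)). Qed.

Lemma ibar_uniq (j : {linear pab -> P}) :
  (forall k l, (0 < k)%N -> (0 < l)%N -> j (p_cls k l) = Abar K ^+ k * Bbar K ^+ l) ->
  j =1 ibar.
Proof.
move=> jE; apply: pab_ind => [k l||c d Hc Hd|a c Hc].
- by rewrite jE ?ibarE.
- by rewrite !linear0.
- by rewrite !linearD Hc Hd.
- by rewrite !linearZ /= Hc.
Qed.

Let mon (k l : nat) : 'X_{1..2} := [multinom if i == 0%R then k else l | i < 2].

Let monE k l : Abar K ^+ k * Bbar K ^+ l = 'X_[mon k l].
Proof.
rewrite /Abar /Bbar [RHS]mpolyXE_id big_ord_recl big_ord1 !mnmE /=.
by rewrite (_ : lift ord0 ord0 = 1); last exact: val_inj.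
Qed.

Let inv_w (w : nat) (q : P) : pab :=
  \sum_(m : 'X_{1..2 < w}) q@_m *: p_cls (m 0%R) (m 1%R).

Let inv_wK c : exists w0, forall w, (w0 <= w)%N -> inv_w w (ibar c) = c.
Proof.
elim/pab_ind: c => [k l||c d [w1 H1] [w2 H2]|a c [w1 H1]].
- exists (mdeg (mon k.+1 l.+1)).+1 => w lw; rewrite ibarE // monE /inv_w.
  rewrite (bigD1 (BMultinom lw)) //= mcoeffX eqxx scale1r !mnmE big1 ?addr0 // => m.
  by rewrite mcoeffX -val_eqE /= eq_sym => /negPf ->; rewrite scale0r.
- by exists 0%N => w _; rewrite linear0 /inv_w big1 // => m _; rewrite mcoeff0 scale0r.
- exists (maxn w1 w2) => w; rewrite geq_max => /andP[l1 l2].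
  rewrite -[in RHS](H1 w) // -[in RHS](H2 w) // -big_split linearD /=.
  by apply: eq_bigr => m _; rewrite mcoeffD scalerDl.
- exists w1 => w lw; rewrite -[in RHS](H1 w) // linearZ /inv_w scaler_sumr.
  by apply: eq_bigr => m _; rewrite /= mcoeffZ scalerA.
Qed.

Lemma ibar_inj : injective ibar.
Proof.
move=> c d e; have [w1 H1] := inv_wK c; have [w2 H2] := inv_wK d.
rewrite -(H1 (maxn w1 w2)) ?leq_maxl // -[RHS](H2 (maxn w1 w2)) ?leq_maxr //.
by rewrite e.
Qed.

Lemma ibar_image (q : P) :
  (exists c, ibar c = q) <-> (exists r, q = Abar K * Bbar K * r).
Proof.
split=> [[c <-]|[r ->]].
- elim/pab_ind: c => [k l||c d [r1 H1] [r2 H2]|a c [r1 H1]].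
  + by rewrite ibarE //; exists (Abar K ^+ k * Bbar K ^+ l); rewrite !exprS; ring.
  + by exists 0; rewrite linear0 mulr0.
  + by exists (r1 + r2); rewrite linearD /= H1 H2 mulrDr.
  + by exists (a *: r1); rewrite linearZ /= H1 scalerAr.
- elim/mpolyind: r => [|a m r _ _ [c Hc]].
    by exists 0; rewrite linear0 mulr0.
  exists (a *: p_cls (m 0%R).+1 (m 1%R).+1 + c).
  rewrite linearD linearZ /= Hc ibarE // mulrDr -scalerAr; congr (_ *: _ + _).
  have -> : m = mon (m 0%R) (m 1%R) :> 'X_{1..2}.
    by apply/mnmP => i; rewrite mnmE; case: i => [[|[|?]] ?] //=;
      congr (m _); apply: val_inj.
  by rewrite -monE !mnmE !exprS /=; ring.
Qed.

End PAb.

(* the class of psi in p / [p, p] *)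
Definition grt1_cls (K : fieldType) (psi : f2 K) (psiP : grt1 psi) :
  lie_ab (derived (f2 K)) := ab_cls (Derived (grt1_derived psiP)).

(* Main.v *)
(* Fix scalars x_1, x_2, x_3. The Lie algebra t_4 acts on affine 3-space: t_ij
   (i, j <= 3) by the infinitesimal Gassner matrix m_ij, sending v to
   (v_i - v_j)(x_i e_j - x_j e_i), and t_i4 by the homothety x_i followed by the
   translation e_i. On pairs (a Id, u), (b Id, v) of affine maps with scalar linear
   part, psi takes the value (0, f(a, b) (a v - b u) / (a b)) where f = i([psi]).
   Up to central elements, all terms of the pentagon but psi(t_12, t_23 + t_24) and
   psi(t_12, t_23) are of this kind, so f gives the translation part tau of
   psi(t_12, t_23 + t_24). This element commutes with t_34, which forces the third
   column of the matrix psi(m_12, m_23) to be x_3 tau. Antisymmetry and the hexagon give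
   the other two diagonal entries in the same way, and since psi(m_12, m_23) is a sum of
   commutators its trace vanishes: this is exactly the cocycle identity
     f(x_1, x_2) + f(x_1 + x_2, x_3) = f(x_1, x_2 + x_3) + f(x_2, x_3).
   A homogeneous cocycle of degree n divisible by AB is a multiple of
   (A + B)^n - A^n - B^n, and for n even the hexagon at (1, 1, -2) kills it. *)
From HB Require Import structures.
Require Import Defs.
From mathcomp Require Import all_boot all_order all_algebra.
From mathcomp Require Import mpoly.
From mathcomp Require Import ring.

Set Implicit Arguments.
Unset Strict Implicit.

Import GRing.Theory.
Local Open Scope ring_scope.

(** * Evaluation of free Lie algebra elements under central shifts of the arguments *)

Section Evaluation.
Context {K : fieldType}.

Lemma lie_morph_ev {L M : lieAlgType K} {h : L -> M} (hm : lie_morph h)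
    (psi : f2 K) (x y : L) : h (f2_ev psi x y) = f2_ev psi (h x) (h y).
Proof.
have [hD hZ hB] := hm.
have [D Z B] := f2_ev_morph x y; have [D' Z' B'] := f2_ev_morph (h x) (h y).
elim/f2_ind: psi => [|||u v Hu Hv|c u Hu|u v Hu Hv].
- by rewrite !f2_evA.
- by rewrite !f2_evB.
- by rewrite (lie_morph0 (f2_ev_morph x y)) (lie_morph0 (f2_ev_morph (h x) (h y)))
    lie_morph0.
- by rewrite D D' hD Hu Hv.
- by rewrite Z Z' hZ Hu.
- by rewrite B B' hB Hu Hv.
Qed.

Lemma f2_ev_comp {L : lieAlgType K} (psi x y : f2 K) (u v : L) :
  f2_ev (f2_ev psi x y) u v = f2_ev psi (f2_ev x u v) (f2_ev y u v).
Proof. exact: (lie_morph_ev (f2_ev_morph u v)). Qed.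

Lemma f2_ev_com {L : lieAlgType K} (psi : f2 K) (z x y : L) :
  [lie z, x] = 0 -> [lie z, y] = 0 -> [lie z, f2_ev psi x y] = 0.
Proof.
move=> zx zy; have [D Z B] := f2_ev_morph x y.
elim/f2_ind: psi => [|||u v Hu Hv|c u Hu|u v Hu Hv].
- by rewrite f2_evA.
- by rewrite f2_evB.
- by rewrite (lie_morph0 (f2_ev_morph x y)) lie_br0r.
- by rewrite D lie_brDr Hu Hv addr0.
- by rewrite Z lie_brZr Hu scaler0.
- by rewrite B lie_adD Hu Hv lie_br0r lie_br0l addr0.
Qed.

Lemma f2_derived_lin (psi : f2 K) :
  psi \in @lie_derived K (f2 K) -> f2_cA psi = 0 /\ f2_cB psi = 0.
Proof.
case/lie_derivedP=> s ->; elim: s => [|q s [IHa IHb]].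
  by rewrite big_nil f2_cA0 f2_cB0.
by rewrite big_cons f2_cAD f2_cBD IHa IHb f2_cAbr f2_cBbr !addr0.
Qed.

(** Shifting the arguments by elements that commute with everything in sight changes no bracket, so
    only the linear part of [psi] can notice, and it vanishes on the commutator subalgebra. *)
Lemma f2_ev_shift {L : lieAlgType K} (psi : f2 K) (x y z w : L) :
  psi \in @lie_derived K (f2 K) ->
  [lie z, x] = 0 -> [lie z, y] = 0 -> [lie w, x] = 0 -> [lie w, y] = 0 ->
  [lie z, w] = 0 -> f2_ev psi (x + z) (y + w) = f2_ev psi x y.
Proof.
move=> psiD zx zy wx wy zw.
(* With the linear correction the formula holds for every [psi], which makes it provable by
   induction. *)
suff -> : f2_ev psi (x + z) (y + w) =
    f2_ev psi x y + (f2_cA psi *: z + f2_cB psi *: w).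
  by case: (f2_derived_lin psiD) => -> ->; rewrite !scale0r !addr0.
have [D Z B] := f2_ev_morph x y; have [D' Z' B'] := f2_ev_morph (x + z) (y + w).
elim/f2_ind: psi {psiD} => [|||u v Hu Hv|c u Hu|u v Hu Hv].
- by rewrite !f2_evA f2_cAA f2_cBA scale1r scale0r addr0.
- by rewrite !f2_evB f2_cAB f2_cBB scale1r scale0r add0r.
- rewrite (lie_morph0 (f2_ev_morph x y)) (lie_morph0 (f2_ev_morph (x + z) (y + w))).
  by rewrite f2_cA0 f2_cB0 !scale0r !addr0.
- by rewrite D D' Hu Hv f2_cAD f2_cBD !scalerDl addrACA [in LHS](addrACA (_ *: z)).
- by rewrite Z Z' Hu f2_cAZ f2_cBZ !scalerDr !scalerA.
have com (a b : K) (t : f2 K) : [lie a *: z + b *: w, f2_ev t x y] = 0.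
  by rewrite lie_brDl !lie_brZl !f2_ev_com // !scaler0 addr0.
have wz : [lie w, z] = 0 by rewrite lie_brC zw oppr0.
have zw_com (a b c d : K) : [lie a *: z + b *: w, c *: z + d *: w] = 0.
  rewrite lie_brDl !lie_brDr !lie_brZl !lie_brZr !lie_brxx zw wz.
  by rewrite !scaler0 !addr0.
rewrite B B' Hu Hv f2_cAbr f2_cBbr !scale0r !addr0.
rewrite lie_brDl (lie_brDr (f2_ev u x y)) (lie_brDr (f2_cA u *: z + _)).
by rewrite com zw_com (lie_brC (f2_ev u x y) (_ + _)) com oppr0 !addr0.
Qed.

(** The model is [t_3] with [x], [y], [z] equal to t_12, t_23, t_13: the hypotheses make [x + y + z]
    commute with [x] and [y], so it may be subtracted from the first argument. *)
Lemma f2_ev_shiftl {L : lieAlgType K} (psi : f2 K) (x y z : L) :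
  psi \in @lie_derived K (f2 K) -> [lie z + y, x] = 0 -> [lie z + x, y] = 0 ->
  f2_ev psi x y = f2_ev psi (- (z + y)) y.
Proof.
move=> psiD zx zy; rewrite -[in LHS](addr0 y) -[x in LHS](addKr (z + y)).
have cy : [lie z + y + x, y] = 0 by rewrite addrAC lie_brDl zy lie_brxx addr0.
rewrite f2_ev_shift ?lie_br0l ?lie_br0r // lie_brNr.
by rewrite lie_brDl lie_brxx add0r lie_brC zx !oppr0.
Qed.

(** Again [x + y + z] commutes with [x] and [y]; since [z] is [- x - y] plus this sum, it can
    replace C in the hexagon. *)
Lemma grt1_hexagon_shift {L : lieAlgType K} (psi : f2 K) (x y z : L) :
  grt1 psi -> [lie z + y, x] = 0 -> [lie z + x, y] = 0 ->
  f2_ev psi x y + f2_ev psi y z + f2_ev psi z x = 0.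
Proof.
move=> g zx zy; have psiD := grt1_derived g.
have [_ hex _] := g; have [D _ _] := f2_ev_morph x y.
have h0 := lie_morph0 (f2_ev_morph x y).
have hN u := lie_morphN u (f2_ev_morph x y).
have := congr1 (fun u => f2_ev u x y) hex.
rewrite /= h0 !D !f2_ev_comp !D !hN !f2_evA !f2_evB => <-.
have cx : [lie z + y + x, x] = 0 by rewrite lie_brDl zx lie_brxx addr0.
have cy : [lie z + y + x, y] = 0 by rewrite addrAC lie_brDl zy lie_brxx addr0.
have cxy : [lie z + y + x, - x - y] = 0 by rewrite lie_brDr !lie_brNr cx cy oppr0 addr0.
have zE : z = - x - y + (z + y + x) by rewrite -opprD (addrC x) -(addrA z) (addrC z) addKr.
congr (_ + _ + _).
  by rewrite -[RHS](f2_ev_shift (z := 0) (w := z + y + x)) ?lie_br0l // addr0 -zE.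
by rewrite -[RHS](f2_ev_shift (z := z + y + x) (w := 0)) ?lie_br0l ?lie_br0r // addr0 -zE.
Qed.

End Evaluation.

(** * Families satisfying the infinitesimal braid relations, and the pentagon for them *)

Section Braids.
Context {K : fieldType} {L : lieAlgType K} {J : eqType}.

Record braid_family (t : J -> J -> L) : Prop := BraidFamily {
  bf_sym i j : i != j -> t i j = t j i;
  bf_tri i j k : uniq [:: i; j; k] -> [lie t i j + t i k, t j k] = 0;
  bf_com i j k l : uniq [:: i; j; k; l] -> [lie t i j, t k l] = 0
}.

Variables (t : J -> J -> L) (tP : braid_family t).

Section Lift.
Variables (s : 'I_4 -> J) (s_inj : injective s).
Let gen (ij : t_index 4) : L := t (s (val ij).1) (s (val ij).2).
Let lift : t_lie K 4 -> L := lp_lift gen.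

Let gen_term (i j : 'I_4) : i != j -> lterm_eval gen (t_term K i j) = t (s i) (s j).
Proof. by move=> ij; rewrite /t_term insubT. Qed.

Let gen_rel u v : t_rel u v -> lterm_eval gen u = lterm_eval gen v.
Proof.
have sE i j : (s i == s j) = (i == j) by rewrite (inj_eq s_inj).
case=> {u v} [i j ij|i j k|i j k l] /=.
- by rewrite gen_term // gen_term 1?eq_sym // (bf_sym tP) ?sE.
- rewrite !inE negb_or => /and3P[/andP[ij ik] jk _].
  by rewrite !gen_term // (bf_tri tP) //= !inE !sE negb_or ij ik jk.
- rewrite !inE !negb_or => /and4P[/and3P[ij ik il] /andP[jk jl] kl _].
  by rewrite !gen_term // (bf_com tP) //= !inE !sE !negb_or ij ik il jk jl kl.
Qed.

Lemma braid_family_morph : lie_morph lift.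
Proof. exact: lp_lift_morph gen_rel. Qed.

Lemma braid_family_ins (I1 I2 I3 : {set 'I_4}) (psi : f2 K) :
  [disjoint I1 & I2] -> [disjoint I1 & I3] -> [disjoint I2 & I3] ->
  lift (f2_ins I1 I2 I3 psi) =
    f2_ev psi (\sum_(a in I1) \sum_(b in I2) t (s a) (s b))
              (\sum_(a in I2) \sum_(b in I3) t (s a) (s b)).
Proof.
move=> d12 d13 d23.
have dI i j : i != j -> [disjoint ins3 I1 I2 I3 i & ins3 I1 I2 I3 j].
  by case: i j => [[|[|[|?]]] ?] [[|[|[|?]]] ?] //= _; rewrite /ins3 //= disjoint_sym.
have hm := braid_family_morph.
rewrite /f2_ins /f2_t3 (lie_morph_ev (t_ins_morph K dI)) (lie_morph_ev hm).
have lneq (i j : nat) : (0 < i <= 3)%N -> (0 < j <= 3)%N -> i != j ->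
    (lbl i : 'I_3) != lbl j.
  move=> /andP[i0 i3] /andP[j0 j3]; rewrite -val_eqE /= !inordK ?prednK //.
  by rewrite -[X in _ -> ~~ X]eqSS !prednK.
have hsum (P Q : {set 'I_4}) : [disjoint P & Q] ->
    lift (\sum_(a in P) \sum_(b in Q) t_gen a b) =
    \sum_(a in P) \sum_(b in Q) t (s a) (s b).
  move=> dPQ; have [hD _ _] := hm.
  rewrite (big_morph _ hD (lie_morph0 hm)); apply: eq_bigr => a aP.
  rewrite (big_morph _ hD (lie_morph0 hm)); apply: eq_bigr => b bQ.
  have ab : a != b.
    by apply: contraTneq bQ => <-; rewrite (disjointFr dPQ aP).
  by rewrite /lift /t_gen lp_lift_cls ?gen_term //; apply: gen_rel.
by rewrite !(t_ins_gen K dI) ?lneq // /ins3 /lbl !inordK //= !hsum.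
Qed.

End Lift.

Lemma braid_family_pentagon (psi : f2 K) (i j k l : J) :
  grt1 psi -> uniq [:: i; j; k; l] ->
  f2_ev psi (t i k + t j k) (t k l) - f2_ev psi (t i j + t i k) (t j l + t k l)
  + f2_ev psi (t i j) (t j k + t j l)
  = f2_ev psi (t j k) (t k l) + f2_ev psi (t i j) (t j k).
Proof.
move=> [_ _ pent] uijkl.
pose s (a : 'I_4) : J := nth i [:: i; j; k; l] a.
have s_inj : injective s.
  by move=> a b /eqP; rewrite nth_uniq ?ltn_ord // => /eqP/val_inj.
have lblE (m : nat) (lm : (m < 4)%N) : lbl m.+1 = Ordinal lm.
  by apply: val_inj; rewrite /= inordK.
have hm := braid_family_morph s_inj; have [hD _ _] := hm.
have := congr1 (lp_lift (fun ij : t_index 4 => t (s (val ij).1) (s (val ij).2))) pent.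
rewrite !hD (lie_morphN _ hm) !braid_family_ins //; last first.
all: try by rewrite ?(lblE 0 isT, lblE 1 isT, lblE 2 isT, lblE 3 isT) disjoint_subset;
    apply/subsetP => x; rewrite !inE -!val_eqE /=; case: x => [[|[|[|[|?]]]] ?].
rewrite ?(lblE 0%N isT, lblE 1%N isT, lblE 2%N isT, lblE 3%N isT).
have sU (F : 'I_4 -> L) (a b : 'I_4) : a != b ->
    \sum_(x in [set a; b]) F x = F a + F b.
  by move=> ab; rewrite big_setU1 ?inE // big_set1.
by rewrite !(sU, big_set1).
Qed.

Let tC i j : i != j -> t j i = t i j.
Proof. by rewrite eq_sym; apply: bf_sym. Qed.

(** The pentagon is solved for one term, and three others are shifted so that they involve only the
    generators ending at strand [l]. For [l = None] in [gassner] these have scalar linear part, so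
    the three terms become computable. *)
Lemma braid_family_pentagon_free (psi : f2 K) (i j k l : J) :
  grt1 psi -> uniq [:: i; j; k; l] ->
  f2_ev psi (t i j) (t j k + t j l) =
    f2_ev psi (t i j) (t j k) + f2_ev psi (- (t j l + t k l)) (t k l)
    + f2_ev psi (- (t i l + (t j l + t k l))) (t j l + t k l)
    - f2_ev psi (- (t i l + t j l + t k l)) (t k l).
Proof.
move=> g u; have psiD := grt1_derived g.
have := u; rewrite /= !inE !negb_or => /and4P[/and3P[ij ik il] /andP[jk jl] kl _].
have ji : j != i by rewrite eq_sym. have ki : k != i by rewrite eq_sym.
have li : l != i by rewrite eq_sym. have kj : k != j by rewrite eq_sym.
have lj : l != j by rewrite eq_sym. have lk : l != k by rewrite eq_sym.
pose nE := (ij, ik, il, jk, jl, kl, ji, ki, li, kj, lj, lk).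
have tri a b c : a != b -> a != c -> b != c -> [lie t a b + t a c, t b c] = 0.
  by move=> ab ac bc; rewrite (bf_tri tP) //= !inE negb_or ab ac bc.
have triR a b c : a != b -> a != c -> b != c -> [lie t b a + t c a, t b c] = 0.
  by move=> ab ac bc; rewrite (tC ab) (tC ac) tri.
have com a b c d : uniq [:: a; b; c; d] -> [lie t a b, t c d] = 0.
  exact: bf_com.
have c1 : [lie t j l, t i k] = 0 by rewrite com //= !inE !negb_or !nE.
have c2 : [lie t i l, t j k] = 0 by rewrite com //= !inE !negb_or !nE.
have c3 : [lie t i k, t j l] = 0 by rewrite com //= !inE !negb_or !nE.
have c4 : [lie t i j, t k l] = 0 by rewrite com //= !inE !negb_or !nE.
have c5 : [lie t k l, t i j] = 0 by rewrite com //= !inE !negb_or !nE.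
have := braid_family_pentagon g u.
(* The three shifts use the central sums of copies of [t_3] with strands ij, k, l, then i, jk, l,
   then j, k, l. *)
rewrite (f2_ev_shiftl (x := t i k + t j k) (z := t i l + t j l)) //; first last.
- by rewrite addrACA lie_brDl (addrC (t i l)) (addrC (t j l)) !tri ?nE ?addr0.
- rewrite lie_brDr {1}addrAC (lie_brDl (t i l + _)) triR ?nE // c1 !add0r.
  by rewrite -addrA lie_brDl triR ?nE // c2 addr0.
rewrite (f2_ev_shiftl (x := t i j + t i k) (z := t i l)) //; first last.
- rewrite lie_brDr {1}addrA (lie_brDl (t i l + _)) (addrC (t i l)) tri ?nE // c3 !add0r.
  by rewrite addrCA lie_brDl (addrC (t i l)) tri ?nE // c4 addr0.
- rewrite lie_brDr {1}addrA (lie_brDl (t i l + _)) triR ?nE // c5 !add0r.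
  by rewrite addrCA lie_brDl triR ?nE // c1 addr0.
rewrite (f2_ev_shiftl (x := t j k) (z := t j l)) //; first last.
- by rewrite addrC tri ?nE.
- by rewrite triR ?nE.
set p := f2_ev _ _ _; set q := f2_ev _ _ _; set r := f2_ev _ _ _; set v := f2_ev _ _ _.
set w := f2_ev _ _ _ => pent; rewrite (addrC w) -pent.
by rewrite (addrAC (p - q)) subrK (addrC (p + r)) addKr.
Qed.

(** Both arguments commute with [t k l], the first by disjointness and the second by the triangle
    relation. *)
Lemma braid_family_com (psi : f2 K) (i j k l : J) : uniq [:: i; j; k; l] ->
  [lie t k l, f2_ev psi (t i j) (t j k + t j l)] = 0.
Proof.
move=> u; have := u; rewrite /= !inE !negb_or => /and4P[/and3P[ij ik il] /andP[jk jl] kl _].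
apply: f2_ev_com.
  rewrite (bf_com tP) //= !inE !negb_or kl (eq_sym k i) (eq_sym k j).
  by rewrite (eq_sym l i) (eq_sym l j) ik jk il jl ij.
by rewrite lie_brC (bf_tri tP) ?oppr0 //= !inE negb_or jk jl kl.
Qed.

End Braids.

(** * The affine Lie algebra and the infinitesimal Gassner representation *)

Definition aff (K : fieldType) (n : nat) : Type := ('M[K]_n * 'cV[K]_n)%type.
HB.instance Definition _ K n := GRing.Lmodule.on (aff K n).

Section Affine.
Context {K : fieldType} {n : nat}.
Implicit Types x y z : aff K n.

(** A pair (M, v) stands for the square matrix of size n + 1 with upper blocks M, v and last row
    zero; this is the matrix commutator. *)
Definition aff_br x y : aff K n :=
  (x.1 *m y.1 - y.1 *m x.1, x.1 *m y.2 - y.1 *m x.2).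

Fact aff_brDl x y z : aff_br (x + y) z = aff_br x z + aff_br y z.
Proof.
by congr (_, _); rewrite /= mulmxDl mulmxDr opprD addrACA.
Qed.
Fact aff_brDr x y z : aff_br x (y + z) = aff_br x y + aff_br x z.
Proof.
by congr (_, _); rewrite /= mulmxDl mulmxDr opprD addrACA.
Qed.
Fact aff_brZl (c : K) x y : aff_br (c *: x) y = c *: aff_br x y.
Proof. by congr (_, _); rewrite /= -scalemxAl -scalemxAr -scalerBr. Qed.
Fact aff_brZr (c : K) x y : aff_br x (c *: y) = c *: aff_br x y.
Proof. by congr (_, _); rewrite /= -scalemxAl -scalemxAr -scalerBr. Qed.
Fact aff_brxx x : aff_br x x = 0.
Proof. by congr (_, _); rewrite /= subrr. Qed.
Fact aff_jacobi x y z :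
  aff_br x (aff_br y z) + aff_br y (aff_br z x) + aff_br z (aff_br x y) = 0.
Proof.
have cyc (V : zmodType) (a b c d e f : V) :
    (a - b - (c - d)) + (c - e - (f - b)) + (f - d - (a - e)) = 0.
  rewrite !opprB !(addrACA _ (- _)) -!opprD (addrC c) (addrC f) (addrC a).
  by rewrite !subrKA subrr.
by congr (_, _); rewrite /= !(mulmxBl, mulmxBr) !mulmxA; apply: cyc.
Qed.
HB.instance Definition _ := isLieAlgebra.Build K (aff K n)
  aff_brDl aff_brDr aff_brZl aff_brZr aff_brxx aff_jacobi.

Lemma aff_derived_tr (psi : f2 K) x y :
  psi \in @lie_derived K (f2 K) -> \tr (f2_ev psi x y).1 = 0.
Proof.
have [D _ B] := f2_ev_morph x y.
case/lie_derivedP=> s ->; elim: s => [|q s IH].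
  by rewrite big_nil (lie_morph0 (f2_ev_morph x y)) mxtrace0.
by rewrite big_cons D B mxtraceD IH addr0 raddfB /= mxtrace_mulC subrr.
Qed.

Variable x : 'I_n -> K.

Definition gassner_col i j : 'cV[K]_n := x i *: delta_mx j 0 - x j *: delta_mx i 0.
Definition gassner_row i j : 'rV[K]_n := delta_mx 0 i - delta_mx 0 j.
(** The factorization through rank one reduces a product of two such matrices to a scalar times a
    column times a row. *)
Definition gassner_mx i j : 'M[K]_n := gassner_col i j *m gassner_row i j.

Lemma gassner_mx_delta i j k :
  gassner_mx i j *m delta_mx k 0 = ((i == k)%:R - (j == k)%:R) *: gassner_col i j.
Proof.
rewrite -mulmxA (mulmxBl _ _ (delta_mx k 0)) !mul_delta_mx_cond.
rewrite -[RHS]mul_mx_scalar; congr (_ *m _).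
apply/matrixP => a b; rewrite !mxE !ord1.
by case: (i == k); case: (j == k); rewrite !mxE.
Qed.

Let gassner_mx_mul i j k l : gassner_mx i j *m gassner_mx k l =
  (x k * ((i == l)%:R - (j == l)%:R) - x l * ((i == k)%:R - (j == k)%:R))
    *: (gassner_col i j *m gassner_row k l).
Proof.
rewrite [gassner_mx k l]/gassner_mx mulmxA [gassner_col k l]/gassner_col.
rewrite (mulmxBr (gassner_mx i j)) -!scalemxAr.
by rewrite !gassner_mx_delta !scalerA -scalerBl -scalemxAl.
Qed.

(* None is the strand whose generators t_{i,None} span the free ideal of the
   braid Lie algebra on which the others act by the Gassner matrices. *)
Definition gassner (a b : option 'I_n) : aff K n :=
  match a, b with
  | Some i, Some j => (gassner_mx i j, 0)
  | Some i, None | None, Some i => ((x i)%:M, delta_mx i 0)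
  | None, None => 0
  end.

(** Scalar matrices are central, so once [None] occurs only translations matter. There
    [gassner_mx i j] sends e_j to [- gassner_col i j], which cancels the contribution of the
    scalars, and it kills e_i + e_j and every other basis vector. *)
Lemma gassner_braid : braid_family gassner.
Proof.
have colN i j : gassner_col i j = - gassner_col j i by rewrite opprB.
have rowN i j : gassner_row i j = - gassner_row j i by rewrite opprB.
have sym i j : gassner_mx i j = gassner_mx j i.
  by rewrite /gassner_mx (colN i) (rowN i) mulNmx mulmxN opprK.
have scal c (M : 'M[K]_n) : c%:M *m M - M *m c%:M = 0.
  by rewrite mul_scalar_mx mul_mx_scalar subrr.
have neq (i j : 'I_n) : Some i != Some j -> ((i == j) = false) * ((j == i) = false).
  by rewrite (inj_eq Some_inj) [j == i]eq_sym => /negPf ->.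
have sN (i : 'I_n) : (Some i != None) = true by [].
split.
- by case=> [i|] [j|] //= _; rewrite sym.
- case=> [i|] [j|] [k|] //=; rewrite !inE ?negb_or ?orbF ?andbT.
  + case/andP=> /andP[/neq ij /neq ik] /neq jk.
    apply: injective_projections; rewrite /= ?addr0 ?mulmx0 ?subrr //.
    rewrite mulmxDl mulmxDr !gassner_mx_mul !(eqxx, ij, ik, jk) /=.
    by apply/matrixP => a b; rewrite !mxE !big_ord1 !mxE; ring.
  + move=> /neq ij; apply: injective_projections; rewrite /= ?add0r.
      by rewrite mul_mx_scalar mul_scalar_mx subrr.
    rewrite mulmxDl gassner_mx_delta !mul_scalar_mx eqxx ij sub0r scaleN1r.
    by rewrite opprB subrK subrr.
  + move=> /neq ij; apply: injective_projections; rewrite /= ?addr0.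
      by rewrite mul_mx_scalar mul_scalar_mx subrr.
    rewrite mulmxDl gassner_mx_delta !mul_scalar_mx eqxx ij sub0r scaleN1r.
    by rewrite opprB addrCA subrr addr0 subrr.
  + move=> /neq ij; apply: injective_projections; rewrite /=.
      by rewrite -raddfD /= mul_mx_scalar mul_scalar_mx subrr.
    rewrite mulmxDr mulmx0 !gassner_mx_delta !(eqxx, ij) -scalerDl.
    by rewrite subrKA subrr scale0r subrr.
- case=> [i|] [j|] [k|] [l|] //=; rewrite !inE ?negb_or ?orbF ?sN /= ?andbF ?andbT //.
  + case/and3P=> /and3P[/neq ij /neq ik /neq il] /andP[/neq jk /neq jl] /neq kl.
    apply: injective_projections; rewrite /= ?addr0 ?mulmx0 ?subrr //.
    rewrite !gassner_mx_mul !(ij, ik, il, jk, jl, kl) /=.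
    by apply/matrixP => a b; rewrite !mxE !big_ord1 !mxE; ring.
  + case/andP=> /andP[/neq ij /neq ik] /neq jk; apply: injective_projections => /=.
      by rewrite mul_mx_scalar mul_scalar_mx subrr.
    by rewrite mulmx0 gassner_mx_delta !(ij, ik, jk) subrr scale0r subrr.
  + case/andP=> /andP[/neq ij /neq ik] /neq jk; apply: injective_projections => /=.
      by rewrite mul_mx_scalar mul_scalar_mx subrr.
    by rewrite mulmx0 gassner_mx_delta !(ij, ik, jk) subrr scale0r subrr.
  + case/andP=> /andP[/neq ij /neq ik] /neq jk; apply: injective_projections => /=.
      by rewrite mul_mx_scalar mul_scalar_mx subrr.
    by rewrite mulmx0 gassner_mx_delta !(ij, ik, jk) subrr scale0r subrr.
  + case/andP=> /andP[/neq ij /neq ik] /neq jk; apply: injective_projections => /=.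
      by rewrite mul_mx_scalar mul_scalar_mx subrr.
    by rewrite mulmx0 gassner_mx_delta !(ij, ik, jk) subrr scale0r subrr.
Qed.

End Affine.

(** * Evaluation at affine maps with scalar linear part *)

Definition pt {K : fieldType} (a b : K) : 'I_2 -> K := fun i => if i == 0 then a else b.

Section ScalarEvaluation.
Context {K : fieldType} {n : nat}.
Variables (a b : K) (u v : 'cV[K]_n).
Let U : aff K n := (a%:M, u).
Let V : aff K n := (b%:M, v).

Let ev_lin (x : f2 K) : (f2_ev x U V).1 = (f2_cA x * a + f2_cB x * b)%:M.
Proof.
have [D Z B] := f2_ev_morph U V.
elim/f2_ind: x => [|||x y Hx Hy|c x Hx|x y Hx Hy].
- by rewrite f2_evA f2_cAA f2_cBA mul1r mul0r addr0.
- by rewrite f2_evB f2_cAB f2_cBB mul1r mul0r add0r.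
- by rewrite (lie_morph0 (f2_ev_morph U V)) f2_cA0 f2_cB0 !mul0r addr0 !raddf0.
- by rewrite D f2_cAD f2_cBD /= Hx Hy -raddfD; congr _%:M; ring.
- by rewrite Z f2_cAZ f2_cBZ /= Hx scale_scalar_mx; congr _%:M; ring.
- rewrite B f2_cAbr f2_cBbr /= Hx Hy mul_scalar_mx mul_mx_scalar subrr.
  by rewrite !mul0r addr0 !raddf0.
Qed.

Lemma scalar_ev_derived1 (x : f2 K) :
  x \in @lie_derived K (f2 K) -> (f2_ev x U V).1 = 0.
Proof.
by move=> xD; rewrite ev_lin; case: (f2_derived_lin xD) => -> ->;
  rewrite !mul0r addr0 !raddf0.
Qed.

Let phi (z : derived (f2 K)) : 'cV[K]_n := (f2_ev (val z) U V).2.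

Let phiD y z : phi (y + z) = phi y + phi z.
Proof. by rewrite /phi /=; case: (f2_ev_morph U V) => -> _ _. Qed.
Let phiZ c z : phi (c *: z) = c *: phi z.
Proof. by rewrite /phi /=; case: (f2_ev_morph U V) => _ -> _. Qed.

(** Elements of the commutator subalgebra evaluate to pure translations, and translations commute,
    so [p, p] is killed. *)
Let phi_ab y z : ab_cls y = ab_cls z -> phi y = phi z.
Proof.
move/ab_clsE; rewrite -{2}(subrK z y) phiD.
case/lie_derivedP=> s ->; elim: s => [|q s IH].
  by rewrite big_nil -(scale0r (0 : derived (f2 K))) phiZ scale0r add0r.
rewrite big_cons phiD -addrA IH /phi /=; case: (f2_ev_morph U V) => _ _ -> /=.
by rewrite !scalar_ev_derived1 ?derived_valP // !mul0mx subrr add0r.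
Qed.

(** On translations, bracketing with [U] and [V] multiplies by [a] and [b], just as ad(A) and ad(B)
    act through [ibar]. The factor [a * b] appears because [A, B] evaluates to [a *: v - b *: u]
    while [ibar] sends it to [Abar * Bbar]. *)
Lemma scalar_ev_derived2 (x : f2 K) (xD : x \in @lie_derived K (f2 K)) :
  (a * b) *: (f2_ev x U V).2 =
    (ibar K (ab_cls (Derived xD))).@[pt a b] *: (a *: v - b *: u).
Proof.
rewrite -[f2_ev x U V]/(f2_ev (val (Derived xD)) U V) -/(phi _).
move: (Derived xD) => {x xD} z; move eq_c: (ab_cls z) => c.
elim/pab_ind: c z eq_c => [k l z|z|c d Hc Hd z|e c Hc z].
- rewrite /p_cls => /phi_ab ->; rewrite ibarE // /phi /= /p_word /=.
  have [D Z B] := f2_ev_morph U V.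
  have -> : f2_ev (iter k (lie_br f2A) (iter l (lie_br f2B) [lie f2A, f2B])) U V =
      (0, (a ^+ k * b ^+ l) *: (a *: v - b *: u)).
    elim: k => [|k IH] /=.
      elim: l => [|l IH] /=.
        rewrite B f2_evA f2_evB; apply: injective_projections => /=.
          by rewrite mul_scalar_mx mul_mx_scalar subrr.
        by rewrite !mul_scalar_mx !expr0 mul1r scale1r.
      rewrite B IH f2_evB; apply: injective_projections => /=.
        by rewrite mulmx0 mul0mx subrr.
      by rewrite mul0mx subr0 mul_scalar_mx scalerA !exprS; congr (_ *: _); ring.
    rewrite B IH f2_evA; apply: injective_projections => /=.
      by rewrite mulmx0 mul0mx subrr.
    by rewrite mul0mx subr0 mul_scalar_mx scalerA !exprS; congr (_ *: _); ring.
  rewrite /= scalerA rmorphM !rmorphXn /= !mevalXU /pt /= !exprS.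
  by congr (_ *: _); ring.
- rewrite -(linear0 (@ab_cls K (derived (f2 K)))) => /phi_ab ->.
  by rewrite !linear0 -(scale0r (0 : derived (f2 K))) phiZ !scale0r scaler0.
- rewrite -(ab_reprK c) -(ab_reprK d) -ab_clsD => /phi_ab ->.
  rewrite phiD scalerDr (Hc _ (ab_reprK c)) (Hd _ (ab_reprK d)) ab_clsD !ab_reprK.
  by rewrite [ibar K (c + d)]linearD mevalD scalerDl.
- have cE : e *: c = ab_cls (e *: repr c) by rewrite linearZ /= ab_reprK.
  rewrite {1}cE => /phi_ab ->.
  rewrite phiZ scalerA mulrC -scalerA (Hc _ (ab_reprK c)).
  by rewrite [ibar K (e *: c)]linearZ /= mevalZ scalerA.
Qed.

End ScalarEvaluation.

(** * The polynomial of [psi]: symmetry, hexagon, homogeneity and cocycle identity *)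

Section Grt1.
Context {K : fieldType} {psi : f2 K}.
Variable psi_grt : grt1 psi.

Definition grt1_poly (a b : K) : K := (ibar K (grt1_cls psi_grt)).@[pt a b].
Local Notation f := grt1_poly.

Lemma grt1_scalar_ev n (a b : K) (u v : 'cV[K]_n) : a != 0 -> b != 0 ->
  f2_ev psi ((a%:M, u) : aff K n) ((b%:M, v) : aff K n) =
    (0, (f a b / (a * b)) *: (a *: v - b *: u)).
Proof.
move=> a0 b0; pose psiD := grt1_derived psi_grt.
apply: injective_projections => /=; first exact: scalar_ev_derived1.
apply: (scalerI (mulf_neq0 a0 b0)); rewrite (scalar_ev_derived2 _ _ _ _ psiD).
by rewrite scalerA mulrCA mulfV ?mulr1 ?mulf_neq0.
Qed.

Lemma grt1_antisym_ev {L : lieAlgType K} (x y : L) :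
  f2_ev psi y x = - f2_ev psi x y.
Proof.
have := congr1 (fun q => f2_ev q x y) (grt1_antisym psi_grt).
by rewrite (lie_morphN _ (f2_ev_morph _ _)) !f2_ev_comp !f2_evA !f2_evB.
Qed.

(** The vector [a *: v - b *: u] already changes sign under the exchange, so antisymmetry of [psi]
    becomes symmetry of [f]. *)
Lemma grt1_poly_sym (a b : K) : a != 0 -> b != 0 -> f a b = f b a.
Proof.
move=> a0 b0.
have := congr1 (fun w : aff K 1 => w.2 0 0) (grt1_antisym_ev (L := aff K 1) (a%:M, 0) (b%:M, 1)).
rewrite !grt1_scalar_ev // !mxE /= !(mulr0, mulr1) sub0r subr0 mulrN => /oppr_inj e.
have -> : f a b = f a b / (a * b) * a * b by field; rewrite a0 b0.
by rewrite -e; field; rewrite a0 b0.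
Qed.

Lemma grt1_poly_hexagon (a b c : K) : a != 0 -> b != 0 -> c != 0 ->
  a + b + c = 0 -> c * f a b + a * f b c + b * f c a = 0.
Proof.
move=> a0 b0 c0 abc.
(* These maps sum to zero, and the vector [a *: v - b *: u] takes the same value [a] on the pairs
   (x, y), (y, z), (z, x). *)
pose x : aff K 1 := (a%:M, 0); pose y : aff K 1 := (b%:M, 1).
pose z : aff K 1 := (c%:M, -1).
have scal e (M : 'M[K]_1) : M *m e%:M - e%:M *m M = 0.
  by rewrite mul_scalar_mx mul_mx_scalar subrr.
have zx : [lie z + y, x] = 0.
  by apply: injective_projections; rewrite /= ?scal // mulmx0 addNr mulmx0 subrr.
have zy : [lie z + x, y] = 0.
  apply: injective_projections; rewrite /= ?scal // addr0 mulmx1 -raddfD /= mulmxN mulmx1.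
  by rewrite opprK -raddfD /= (addrC c) addrAC abc raddf0.
have := congr1 (fun w : aff K 1 => w.2 0 0) (grt1_hexagon_shift psi_grt zx zy).
rewrite !grt1_scalar_ev // /= !mxE /= !(mulr0, mulr1, subr0, sub0r, mulrN, opprK).
have -> : - b - c = a by apply/esym/eqP; rewrite -subr_eq0 opprD !opprK addrA abc.
by move=> h; rewrite -[RHS](mulr0 (b * c)) -h; field; rewrite a0 b0 c0.
Qed.

Lemma f2_homog_ev (L : lieAlgType K) n (x y : L) (c : K) (q : f2 K) :
  f2_homog n q -> f2_ev q (c *: x) (c *: y) = c ^+ n *: f2_ev q x y.
Proof.
have [D Z B] := f2_ev_morph x y; have [D' Z' B'] := f2_ev_morph (c *: x) (c *: y).
elim=> {n q} [||n|n p q _ Hp _ Hq|n e p _ Hp|m n p q _ Hp _ Hq].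
- by rewrite !f2_evA.
- by rewrite !f2_evB.
- rewrite (lie_morph0 (f2_ev_morph x y)) (lie_morph0 (f2_ev_morph (c *: x) (c *: y))).
  by rewrite scaler0.
- by rewrite D D' Hp Hq scalerDr.
- by rewrite Z Z' Hp !scalerA mulrC.
- by rewrite B B' Hp Hq lie_brZl lie_brZr scalerA exprD.
Qed.

Lemma grt1_poly_homog n (c a b : K) : f2_homog n psi ->
  c != 0 -> a != 0 -> b != 0 -> f (c * a) (c * b) = c ^+ n * f a b.
Proof.
move=> psi_deg c0 a0 b0.
have sE e u : c *: ((e%:M, u) : aff K 1) = ((c * e)%:M, c *: u).
  by apply: injective_projections; rewrite /= ?scale_scalar_mx.
have := congr1 (fun w : aff K 1 => w.2 0 0)
  (f2_homog_ev ((a%:M, 0) : aff K 1) ((b%:M, 1) : aff K 1) c psi_deg).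
rewrite !sE !grt1_scalar_ev ?mulf_neq0 //.
rewrite /= !mxE /= !(mulr0, mulr1, subr0) => e.
have -> : f (c * a) (c * b) = f (c * a) (c * b) / (c * a * (c * b)) * (c * a * c) * b.
  by field; rewrite a0 b0 c0.
by rewrite e; field; rewrite a0 b0.
Qed.

(** Commutation with (x_k, e_k) forces M e_k = x_k tau for the linear part M and translation tau of
    the solved pentagon term. The coefficients of the three quotients are the k-th coordinates of
    the vectors in [grt1_scalar_ev], with the sign of each term. *)
Lemma grt1_gassner_diag n (x : 'I_n -> K) (i j k : 'I_n) : uniq [:: i; j; k] ->
  x k != 0 -> x j + x k != 0 -> x i + x j + x k != 0 ->
  (f2_ev psi (gassner x (Some i) (Some j)) (gassner x (Some j) (Some k))).1 k k =
    x k * ((x i + x j) * (f (- (x i + x j + x k)) (x k) / (- (x i + x j + x k) * x k))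
    - x i * (f (- (x i + x j + x k)) (x j + x k) / (- (x i + x j + x k) * (x j + x k)))
    - x j * (f (- (x j + x k)) (x k) / (- (x j + x k) * x k))).
Proof.
move=> u xk xjk xijk; set Psi := f2_ev _ _ _.
have u4 : uniq [:: Some i; Some j; Some k; None].
  by move: u; rewrite /= !inE !orbF.
have := u; rewrite /= !inE negb_or => /and3P[/andP[_ /negPf ik] /negPf jk _].
have := braid_family_com (gassner_braid x) psi u4.
rewrite (braid_family_pentagon_free (gassner_braid x) psi_grt u4) -/Psi /=.
have addE a b (v w : 'cV[K]_n) :
    ((a%:M, v) : aff K n) + ((b%:M, w) : aff K n) = ((a + b)%:M, v + w).
  by apply: injective_projections; rewrite /= ?raddfD.
have oppE a (v : 'cV[K]_n) : - ((a%:M, v) : aff K n) = ((- a)%:M, - v).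
  by apply: injective_projections; rewrite /= ?raddfN.
rewrite !addE !oppE !grt1_scalar_ev ?oppr_eq0 ?addrA //.
(* Generators between two strands other than [None] have no translation part. *)
have -> : Psi = (Psi.1, 0).
  apply: injective_projections => //=; rewrite {}/Psi.
  have [D Z B] := f2_ev_morph (gassner x (Some i) (Some j)) (gassner x (Some j) (Some k)).
  elim/f2_ind: psi => [|||p q Hp Hq|c p Hp|p q Hp Hq].
  - by rewrite f2_evA.
  - by rewrite f2_evB.
  - by rewrite (lie_morph0 (f2_ev_morph _ _)).
  - by rewrite D /= Hp Hq addr0.
  - by rewrite Z /= Hp scaler0.
  - by rewrite B /= Hp Hq !mulmx0 subrr.
move/(congr1 (fun w : aff K n => w.2 k 0)) => /=.
set P := f _ _ / _; set Q := f _ _ / _; set R := f _ _ / _.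
rewrite !(addr0, subr0) mul_scalar_mx -colE !mxE !(eq_sym k) ik jk !eqxx /=.
by move/eqP; rewrite subr_eq0 => /eqP <-; ring.
Qed.

Lemma grt1_poly_cocycle (a b c : K) : a != 0 -> b != 0 -> c != 0 ->
  a + b != 0 -> b + c != 0 -> a + b + c != 0 ->
  f a b + f (a + b) c = f a (b + c) + f b c.
Proof.
move=> a0 b0 c0 ab bc abc; pose x (i : 'I_3) := [:: a; b; c]`_i.
pose i0 := @Ordinal 3 0 isT; pose i1 := @Ordinal 3 1 isT; pose i2 := @Ordinal 3 2 isT.
have xE : (x i0 = a) * (x i1 = b) * (x i2 = c) by [].
pose G i j := gassner x (Some i) (Some j).
have GC i j : i != j -> G i j = G j i by move=> ij; apply: (bf_sym (gassner_braid x)).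
(* Both terms on the right end at strand [i1], as [grt1_gassner_diag] requires for the middle
   diagonal entry. *)
have hex : f2_ev psi (G i0 i1) (G i1 i2) =
    f2_ev psi (G i0 i2) (G i2 i1) - f2_ev psi (G i2 i0) (G i0 i1).
  have h1 : [lie G i2 i0 + G i1 i2, G i0 i1] = 0.
    by rewrite (GC i1 i2) //; apply: (bf_tri (gassner_braid x)).
  have h2 : [lie G i2 i0 + G i0 i1, G i1 i2] = 0.
    by rewrite (GC i2 i0) // addrC; apply: (bf_tri (gassner_braid x)).
  have /eqP := grt1_hexagon_shift psi_grt h1 h2.
  rewrite -addrA addr_eq0 => /eqP ->; rewrite opprD; congr (_ - _).
  by rewrite (grt1_antisym_ev (G i2 i0)) opprK (GC i2 i0) // (GC i1 i2).
have trE (M : 'M[K]_3) : \tr M = M i0 i0 + M i1 i1 + M i2 i2.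
  rewrite /mxtrace !big_ord_recl big_ord0 addr0 addrA.
  by congr (M _ _ + M _ _ + M _ _); apply: val_inj.
have tr0 := aff_derived_tr (G i0 i1) (G i1 i2) (grt1_derived psi_grt).
(* This is the vanishing trace: the last entry is direct, the first uses antisymmetry and the middle
   one uses [hex]. *)
have : (f2_ev psi (G i0 i1) (G i1 i2)).1 i2 i2 - (f2_ev psi (G i2 i1) (G i1 i0)).1 i0 i0
  + ((f2_ev psi (G i0 i2) (G i2 i1)).1 i1 i1 - (f2_ev psi (G i2 i0) (G i0 i1)).1 i1 i1) = 0.
  rewrite (GC i2 i1) // (GC i1 i0) // (grt1_antisym_ev (G i0 i1)).
  have := congr1 (fun w : aff K 3 => w.1 i1 i1) hex.
  rewrite /= !mxE opprK (GC i2 i1) // => <-.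
  by rewrite -tr0 trE; ring.
have e1 : c + b + a = a + b + c by ring.
have e2 : c + a + b = a + b + c by ring.
have e3 : a + c + b = a + b + c by ring.
rewrite !grt1_gassner_diag ?xE ?e1 ?e2 ?e3 ?(addrC b a) ?(addrC c b) //.
(* The hexagon at (u, v, -(u + v)) rewrites the cocycle identity in the quotients that occur in the
   diagonal entries; it then becomes linear in them and equals the trace identity up to sign. *)
have hexd u v : u != 0 -> v != 0 -> u + v != 0 ->
    f u v = - (u * v) * (f (- (u + v)) u / (- (u + v) * u) + f (- (u + v)) v / (- (u + v) * v)).
  move=> u0 v0 uv0; have w0 : - (u + v) != 0 by rewrite oppr_eq0.
  have := grt1_poly_hexagon u0 v0 w0 (subrr _).
  rewrite (grt1_poly_sym v0 w0); set p := f u v; set q := f _ v; set r := f _ u => h.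
  have -> : p = (u * q + v * r) / (u + v).
    apply: (mulIf uv0); rewrite divfK //; apply/eqP; rewrite -subr_eq0 -oppr_eq0 -h.
    by apply/eqP; ring.
  by field; rewrite u0 v0 uv0 w0.
rewrite (hexd a b) // (hexd (a + b) c) // (hexd a (b + c)) ?addrA // (hexd b c) //.
set p1 := f (- (a + b)) a / _; set p2 := f (- (a + b)) b / _.
set p3 := f (- (b + c)) b / _; set p4 := f (- (b + c)) c / _.
set p5 := f _ c / _; set p6 := f _ (b + c) / _; set p7 := f _ a / _.
set p8 := f _ (a + b) / _; set p9 := f _ b / _ => h.
apply/eqP; rewrite -subr_eq0 -oppr_eq0 -[X in _ == X]h; apply/eqP; ring.
Qed.

End Grt1.

(** * Polynomial identities in characteristic zero and homogeneous cocycles *)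

Section Polynomials.
Context {K : fieldType} (charK : [pchar K] =i pred0).

(** The product [p * s] vanishes at every point, in particular at more integers, distinct in
    characteristic zero, than its degree allows. *)
Lemma poly_eq0_generic (p s : {poly K}) :
  s != 0 -> (forall a, s.[a] != 0 -> p.[a] = 0) -> p = 0.
Proof.
move=> s0 sp; apply/eqP/negPn/negP => p0.
have ps0 : p * s != 0 by rewrite mulf_neq0.
pose r : seq K := [seq i%:R | i <- iota 0 (size (p * s)%R)].
have rU : uniq r.
  rewrite map_inj_uniq ?iota_uniq // => i j.
  wlog ij : i j / (i <= j)%N => [h e|/eqP].
    by case/orP: (leq_total i j) => /h -> //.
  rewrite eq_sym -subr_eq0 -natrB // (pcharf0P K).1 // subn_eq0 => ji.
  by apply/eqP; rewrite eqn_leq ij.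
suff : all (root (p * s)) r.
  by move/(max_poly_roots ps0)/(_ rU); rewrite size_map size_iota ltnn.
apply/allP => a _; rewrite rootE hornerM.
by have [->|/sp ->] := eqVneq s.[a] 0; rewrite ?mulr0 ?mul0r.
Qed.

Definition slice (p : {mpoly K[2]}) (a : K) : {poly K} :=
  \sum_(m <- msupp p) (p@_m * a ^+ m 0%R) *: 'X^(m 1%R).

Lemma horner_slice p a b : (slice p a).[b] = p.@[pt a b].
Proof.
rewrite mevalE horner_sum; apply: eq_bigr => m _.
rewrite hornerZ hornerXn -mulrA; congr (_ * _).
rewrite big_ord_recl big_ord1 /pt /=; congr (_ * _ ^+ m _); exact: val_inj.
Qed.

(** The univariate case is applied twice: to [p] as a polynomial in the second variable, then to
    each of its coefficients as a polynomial in the first. *)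
Lemma mpoly_eq0_generic (p : {mpoly K[2]}) :
  (forall a b, a != 0 -> b != 0 -> p.@[pt a b] = 0) -> p = 0.
Proof.
move=> p0; have X0 : 'X != 0 :> {poly K} by rewrite polyX_eq0.
have slice0 a : a != 0 -> slice p a = 0.
  move=> a0; apply: (poly_eq0_generic X0) => b; rewrite hornerX => b0.
  by rewrite horner_slice p0.
have row0 j : \sum_(m <- msupp p | m 1%R == j) p@_m *: 'X^(m 0%R) = 0 :> {poly K}.
  apply: (poly_eq0_generic X0) => a; rewrite hornerX => /slice0 sa.
  have := congr1 (fun q : {poly K} => q`_j) sa; rewrite coef0 => <-.
  rewrite coef_sum horner_sum big_mkcond; apply: eq_bigr => m _.
  rewrite coefZ coefXn eq_sym; case: eqP => _; rewrite ?mulr1 ?mulr0 //.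
  by rewrite hornerZ hornerXn.
apply/mpolyP => m; rewrite mcoeff0.
have [mp|/memN_msupp_eq0 //] := boolP (m \in msupp p).
have := congr1 (fun q : {poly K} => q`_(m 0%R)) (row0 (m 1%R)); rewrite coef0 => <-.
rewrite coef_sum big_mkcond (bigD1_seq m) //= eqxx coefZ coefXn eqxx mulr1.
rewrite big1 ?addr0 // => k km; case: eqP => // k1.
rewrite coefZ coefXn; case: eqP => k0; rewrite ?mulr0 //.
case/eqP: km; apply/mnmP => i; case: i => [[|[|?]] ?] //.
  by rewrite (_ : Ordinal _ = 0) //; apply: val_inj.
by rewrite (_ : Ordinal _ = 1) //; apply: val_inj.
Qed.

Lemma deriv_eq0 (p : {poly K}) : p^`() = 0 -> p.[0] = 0 -> p = 0.
Proof.
move=> dp p0; apply/polyP => -[|i]; rewrite coef0; first by rewrite -horner_coef0.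
have := congr1 (fun q : {poly K} => q`_i) dp; rewrite coef0 coef_deriv => /eqP.
by rewrite -mulr_natr mulf_eq0 (pcharf0P K).1 // orbF => /eqP.
Qed.

Lemma cocycle_eval (a b : K) n :
  ((Abar K + Bbar K) ^+ n - Abar K ^+ n - Bbar K ^+ n).@[pt a b] =
  (a + b) ^+ n - a ^+ n - b ^+ n.
Proof. by rewrite !mevalB !rmorphXn /= mevalD !mevalXU. Qed.

(* Differentiating the cocycle identity in its third variable at 0 determines the
   derivative of f(1, X). *)
Lemma homogeneous_cocycle (f : {mpoly K[2]}) (m : nat) :
  (forall c a b, c != 0 -> a != 0 -> b != 0 ->
     f.@[pt (c * a) (c * b)] = c ^+ m.+1 * f.@[pt a b]) ->
  (forall a b c, a != 0 -> b != 0 -> c != 0 ->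
     a + b != 0 -> b + c != 0 -> a + b + c != 0 ->
     f.@[pt a b] + f.@[pt (a + b) c] = f.@[pt a (b + c)] + f.@[pt b c]) ->
  f.@[pt 1 0] = 0 ->
  exists c : K, f = c *: ((Abar K + Bbar K) ^+ m.+1 - Abar K ^+ m.+1 - Bbar K ^+ m.+1).
Proof.
move=> fZ fC f10; pose q := slice f 1; pose k := q^`().[0].
have fE a b : a != 0 -> b != 0 -> f.@[pt a b] = a ^+ m.+1 * q.[b / a].
  move=> a0 b0; rewrite horner_slice -fZ ?oner_eq0 ?mulf_neq0 ?invr_eq0 //.
  by rewrite mulr1 mulrC divfK.
have qd v : v != 0 -> 1 + v != 0 -> q^`().[v] = k * ((1 + v) ^+ m - v ^+ m).
  move=> v0 v1.
  (* [G] is the cocycle identity at (1, v, X), written through [q] by homogeneity; it is known only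
     away from the zeros of X, X + v and X + 1 + v. *)
  pose G := q.[v]%:P + (1 + v) ^+ m.+1 *: (q \Po ((1 + v)^-1 *: 'X))
    - (q \Po ('X + v%:P)) - v ^+ m.+1 *: (q \Po (v^-1 *: 'X)).
  have G0 : G = 0.
    apply: (@poly_eq0_generic _ ('X * ('X + v%:P) * ('X + (1 + v)%:P))).
      by rewrite !mulf_neq0 ?polyX_eq0 // -size_poly_eq0 size_XaddC.
    move=> t st; have /and3P[t0 vt vt1] : [&& t != 0, t + v != 0 & t + (1 + v) != 0].
      move: st; rewrite !hornerM !hornerD hornerX !hornerC !mulf_eq0 !negb_or.
      by rewrite andbA.
    have vt' : v + t != 0 by rewrite addrC.
    have vt1' : 1 + v + t != 0 by rewrite addrC.
    have := fC 1 v t (oner_neq0 _) v0 t0 v1 vt' vt1'.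
    rewrite !fE ?oner_eq0 // !divr1 !expr1n !mul1r => h.
    rewrite /G !(hornerE, horner_comp) /=.
    by rewrite (addrC t) ![_^-1 * t]mulrC -addrA -opprD h subrr.
  have := congr1 (fun p : {poly K} => p^`().[0]) G0.
  rewrite deriv0 horner0 /G !derivE !deriv_comp !derivE !hornerE !horner_comp !hornerE /=.
  rewrite !mulr1 -/k => h.
  have hE w : w != 0 -> w ^+ m.+1 * k / w = k * w ^+ m.
    by move=> w0; rewrite exprS; field.
  apply/eqP; rewrite -subr_eq0 -oppr_eq0 -[X in _ == X]h !hE //; apply/eqP; ring.
(* Integrating [qd] divides by m + 1; the constant of integration is fixed by f(1, 0) = 0. *)
pose c := k / m.+1%:R; have n0 : m.+1%:R != 0 :> K by rewrite (pcharf0P K).1.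
have qE : q = c *: (('X + 1) ^+ m.+1 - 'X ^+ m.+1 - 1).
  apply/eqP; rewrite -subr_eq0; apply/eqP/deriv_eq0.
    apply: (@poly_eq0_generic _ ('X * ('X + 1%:P))).
      by rewrite mulf_neq0 ?polyX_eq0 // -size_poly_eq0 size_XaddC.
    move=> v; rewrite !hornerE mulf_eq0 negb_or (addrC v) => /andP[v0 v1].
    rewrite !derivE !deriv_exp !derivE !hornerE /= qd // /c.
    rewrite !hornerMn horner_exp hornerXn hornerD hornerX hornerC (addrC v) subr0.
    rewrite -mulrnBl -(mulr_natr (_ - _) m.+1).
    by rewrite (mulrC _ m.+1%:R) mulrA divfK // subrr.
  by rewrite !hornerE horner_slice f10 /= expr1n expr0n /= subr0 subrr mulr0 subr0.
exists c; apply/eqP; rewrite -subr_eq0; apply/eqP/mpoly_eq0_generic => a b a0 b0.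
rewrite mevalB mevalZ cocycle_eval fE // qE.
rewrite hornerZ !hornerD !hornerN !horner_exp hornerD !hornerX hornerC.
have -> : b / a + 1 = (a + b) / a by field.
rewrite !expr_div_n.
have an0 : a ^+ m.+1 != 0 by rewrite expf_neq0.
by field.
Qed.

End Polynomials.

(** * Low degrees, parity and the conclusion *)

Lemma f2_homog0_eq0 (K : fieldType) (x : f2 K) : f2_homog 0 x -> x = 0.
Proof.
move=> x0; have gen n (y : f2 K) : f2_homog n y -> n = 0%N -> y = 0.
  elim=> {n y} // [n p q _ Hp _ Hq n0|n c p _ Hp n0|m n p q _ Hp _ _ /eqP].
  - by rewrite Hp // Hq // addr0.
  - by rewrite Hp // scaler0.
  - by rewrite addn_eq0 => /andP[/eqP m0 _]; rewrite Hp // lie_br0l.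
exact: gen x0 _.
Qed.

(** The image of [ibar] is divisible by [Abar * Bbar], which vanishes at (1, 0). *)
Lemma grt1_poly10 (K : fieldType) (psi : f2 K) (psi_grt : grt1 psi) :
  grt1_poly psi_grt 1 0 = 0.
Proof.
have [/(_ (ex_intro _ _ erefl))[r rE] _] := ibar_image (ibar K (grt1_cls psi_grt)).
by rewrite /grt1_poly rE !mevalM !mevalXU /pt /= mulr0 mul0r.
Qed.

Unset Implicit Arguments.

Theorem theorem0p1 (K : fieldType) (charK : [pchar K] =i pred0) (n : nat)
    (psi : f2 K) (psi_grt : grt1 psi) (psi_deg : f2_homog n psi) :
  (odd n -> (3 <= n)%N ->
     exists c : K, ibar K (grt1_cls psi_grt) =
       c *: ((Abar K + Bbar K) ^+ n - Abar K ^+ n - Bbar K ^+ n))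
  /\ (~~ (odd n && (3 <= n)%N) -> grt1_cls psi_grt = 0).
Proof.
case: n psi_deg => [|m] psi_deg.
  split=> // _; apply/ab_cls_eq0; rewrite (_ : Derived _ = 0) ?rpred0 //.
  by apply: val_inj; apply: f2_homog0_eq0.
have [c cE] : exists c : K, ibar K (grt1_cls psi_grt) =
    c *: ((Abar K + Bbar K) ^+ m.+1 - Abar K ^+ m.+1 - Bbar K ^+ m.+1).
  apply: (homogeneous_cocycle charK); last exact: grt1_poly10.
    by move=> c a b; apply: grt1_poly_homog.
  exact: grt1_poly_cocycle.
split=> [_ _|not_odd]; first by exists c.
apply: (@ibar_inj K); rewrite linear0 cE.
case odd_m: (odd m.+1) not_odd => /= m3.
  (* The only odd degree below 3 is 1, where (A + B) - A - B is zero. *)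
  case: m {psi_deg cE} odd_m m3 => [|[|m]] //= _ _.
  by rewrite !expr1 addrAC addrK subrr scaler0.
suff -> : c = 0 by rewrite scale0r.
have n2 : 2%:R != 0 :> K by rewrite (pcharf0P K).1.
have fE a b : grt1_poly psi_grt a b = c * ((a + b) ^+ m.+1 - a ^+ m.+1 - b ^+ m.+1).
  by rewrite /grt1_poly cE mevalZ cocycle_eval.
have := @grt1_poly_hexagon _ _ psi_grt 1 1 (- 2%:R).
rewrite oner_eq0 oppr_eq0 !fE => /(_ isT isT n2).
have -> : 1 + 1 - 2%:R = 0 :> K by ring.
have evN (x : K) : (- x) ^+ m.+1 = x ^+ m.+1 by rewrite exprNn -signr_odd /= odd_m mul1r.
have -> : 1 - 2%:R = - 1 :> K by ring.
have -> : - 2%:R + 1 = - 1 :> K by ring.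
have -> : 1 + 1 = 2%:R :> K by ring.
rewrite !evN expr1n => /(_ erefl) h.
(* In even degree n the hexagon at (1, 1, -2) reads -4c(2^n - 1) = 0; the factor is kept as a
   natural number so that characteristic zero shows it nonzero. *)
have /eqP : c * (4 * (2 ^ m.+1 - 1))%N%:R = 0.
  rewrite natrM natrB ?expn_gt0 // natrX -[RHS]oppr0 -[in RHS]h; ring.
have n2m : (1 < 2 ^ m.+1)%N by rewrite -{1}(expn0 2) ltn_exp2l.
by rewrite mulf_eq0 (pcharf0P K).1 // muln_eq0 subn_eq0 leqNgt n2m orbF => /eqP.
Qed.
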